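(* Let $x_1,\ldots,x_n\in\mathbb{R}^d$ and $w=(w_1,\ldots,w_n)$ with $w_i>0$ and $\sum_{i=1}^n w_i=1$. Assume that any subset of at most $d$ of the samples $x_i$, $i\in\{1,\ldots,n\}$, is linearly independent and that $\max\{w_i: i=1,\ldots,n\}<\frac1d$. Let $L:\mathbb{R}_{>0}\times\mathrm{SPD}(d)\to\mathbb{R}$ be the function $$L(\nu,\Sigma)=-2\log\Gamma\left(\tfrac{d+\nu}{2}\right)+2\log\Gamma\left(\tfrac{\nu}{2}\right)-\nu\log(\nu)+(d+\nu)\sum_{i=1}^n w_i\log\left(\nu+x_i^{T}\Sigma^{-1}x_i\right)+\log|\Sigma|.$$ Then exactly one of the following holds: (i) There exists a minimizing sequence $(\nu_r,\Sigma_r)_r$ of $L$ such that $(\nu_r)_r$ has a finite cluster point. In this case $\operatorname{argmin}_{(\nu,\Sigma)\in\mathbb{R}_{>0}\times\mathrm{SPD}(d)}L(\nu,\Sigma)\neq\emptyset$, and every $(\hat\nu,\hat\Sigma)\in\operatorname{argmin}_{(\nu,\Sigma)\in\mathbb{R}_{>0}\times\mathrm{SPD}(d)}L(\nu,\Sigma)$ is a critical point of $L$. (ii) For every minimizing sequence $(\nu_r,\Sigma_r)_r$ of $L$ we have $\lim_{r\to\infty}\nu_r=\infty$. In this case, for every minimizing sequence, $(\Sigma_r)_r$ converges to $\hat\Sigma=\sum_{i=1}^n w_i x_i x_i^{T}$ (the maximum likelihood estimator of $\Sigma$ for the normal distribution $\mathcal{N}(0,\Sigma)$).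
   Context: $\mathrm{SPD}(d)$ is the set of symmetric positive definite real $d\times d$ matrices, $|\Sigma|$ is the determinant, and $\Gamma$ is the Gamma function. A minimizing sequence of $L$ is a sequence $(\nu_r,\Sigma_r)_r$ in $\mathbb{R}_{>0}\times\mathrm{SPD}(d)$ with $L(\nu_r,\Sigma_r)\to\inf_{\mathbb{R}_{>0}\times\mathrm{SPD}(d)}L$. A finite cluster point of $(\nu_r)_r$ is a finite limit (in $\mathbb{R}$) of some subsequence. A critical point of $L$ is a point at which the derivatives of $L$ with respect to $\nu$ and $\Sigma$ vanish. Up to constants and scaling, $L$ is the (weighted) negative log-likelihood of the $d$-dimensional Student-$t$ distribution with $\nu$ degrees of freedom, location $0$ and scatter matrix $\Sigma$. *)

(* Defs.v *)
From HB Require Import structures.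
From mathcomp Require Import all_boot all_order all_algebra.
From mathcomp Require Import all_classical all_reals all_analysis.

Set Implicit Arguments.
Unset Strict Implicit.
Unset Printing Implicit Defensive.

Import Order.TTheory GRing.Theory Num.Theory.
Import numFieldNormedType.Exports.

Local Open Scope classical_set_scope.
Local Open Scope ring_scope.

(* Euler's integral; it is finite exactly when 0 < s, the only range used. *)
Definition Gamma (R : realType) (s : R) : R :=
  \int[lebesgue_measure]_(t in `]0, +oo[) (t `^ (s - 1) * expR (- t)).

Definition sym_mx (R : realType) (d : nat) : set 'M[R]_d :=
  [set A | A^T = A].

Definition SPD (R : realType) (d : nat) : set 'M[R]_d :=
  [set A | A^T = A /\
    forall v : 'cV[R]_d, v != 0 -> 0 < (v^T *m A *m v) ord0 ord0].

(* x^T Sigma^-1 x *)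
Definition mahalanobis (R : realType) (d : nat)
    (Sigma : 'M[R]_d) (x : 'cV[R]_d) : R :=
  (x^T *m invmx Sigma *m x) ord0 ord0.

(* invmx, ln, \det are total, so this is a total function; only its values on
   0 < nu and SPD Sigma are meaningful. *)
Definition tL (R : realType) (d n : nat) (x : 'I_n -> 'cV[R]_d) (w : 'I_n -> R)
    (nu : R) (Sigma : 'M[R]_d) : R :=
  - 2 * ln (Gamma ((d%:R + nu) / 2)) + 2 * ln (Gamma (nu / 2)) - nu * ln nu
  + (d%:R + nu) * \sum_(i < n) w i * ln (nu + mahalanobis Sigma (x i))
  + ln (\det Sigma).

Section OptimizationNotions.
Context (R : realType) (d : nat) (L : R -> 'M[R]_d -> R).

Definition dom : set (R * 'M[R]_d) := [set p | 0 < p.1 /\ SPD p.2].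

(* Taken in \bar R, so that it is the true infimum even if L were unbounded
   below. *)
Definition infL : \bar R := ereal_inf [set (L p.1 p.2)%:E | p in dom].

Definition minimizing_seq (nu : nat -> R) (Sigma : nat -> 'M[R]_d) : Prop :=
  (forall r, dom (nu r, Sigma r)) /\
  (L (nu r) (Sigma r))%:E @[r --> \oo] --> infL.

Definition argminL : set (R * 'M[R]_d) :=
  [set p | dom p /\ forall q, dom q -> L p.1 p.2 <= L q.1 q.2].

(* SPD(d) is open in the space of symmetric matrices, not in 'M_d; hence the
   derivative in Sigma is the Frechet derivative along symmetric increments,
   which only involves values of L on its domain. *)
Definition critical_point (p : R * 'M[R]_d) : Prop :=
  is_derive p.1 1 (fun nu => L nu p.2) 0 /\
  let sym_nbhs0 := within (@sym_mx R d) (nbhs (0 : 'M[R]_d)) in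
  (fun H : 'M[R]_d => L p.1 (p.2 + H) - L p.1 p.2) =o_sym_nbhs0 id.

End OptimizationNotions.

Definition finite_cluster_point (R : realType) (u : nat -> R) (a : R) : Prop :=
  exists2 f : nat -> nat, increasing_seq f & u (f k) @[k --> \oo] --> a.

(* Density of the centered normal distribution N(0, Sigma) on R^d. *)
Definition mvnormal_pdf (R : realType) (d : nat)
    (Sigma : 'M[R]_d) (x : 'cV[R]_d) : R :=
  (2 * pi) `^ (- (d%:R / 2)) * (\det Sigma) `^ (- 2^-1)
  * expR (- (mahalanobis Sigma x / 2)).

Definition normal_loglik (R : realType) (d n : nat) (x : 'I_n -> 'cV[R]_d)
    (w : 'I_n -> R) (Sigma : 'M[R]_d) : R :=
  \sum_(i < n) w i * ln (mvnormal_pdf Sigma (x i)).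

Definition normal_MLE (R : realType) (d n : nat) (x : 'I_n -> 'cV[R]_d)
    (w : 'I_n -> R) : set 'M[R]_d :=
  [set S | SPD S /\
    forall T, SPD T -> normal_loglik x w T <= normal_loglik x w S].

(* Main.v *)
Require Import Defs.
From HB Require Import structures.
From mathcomp Require Import all_boot all_order all_algebra.
From mathcomp Require Import all_classical all_reals all_analysis.
From mathcomp Require Import measurable_realfun ring lra.

Set Implicit Arguments.
Unset Strict Implicit.
Unset Printing Implicit Defensive.

Import Order.TTheory GRing.Theory Num.Theory.
Import numFieldNormedType.Exports.

Local Open Scope classical_set_scope.
Local Open Scope ring_scope.

(* Writing [L = G(nu) + (d + nu) sum_i w_i ln (1 + delta_i / nu) + ln |Sigma|]
   with [delta_i = x_i^T Sigma^-1 x_i], everything rests on one coercivity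
   estimate. Since [d w] lies in the hypersimplex, [d sum_i w_i y_i] is at least
   the sum of the [d] smallest [y_i], and Hadamard's inequality for
   [X_I^T Sigma^-1 X_I] bounds [sum_(i in I) ln delta_i + ln |Sigma|] below for
   every [I] of size [d]. What is left of [(d + nu) sum_i w_i ln (1 + delta_i / nu)]
   then bounds all [delta_i], so [Sigma_r] stays in a compact part of SPD(d)
   along any minimizing sequence with [nu_r] bounded away from 0 (possibly
   unbounded); [nu_r -> 0] is excluded by the pole of Gamma at 0. As [nu -> oo],
   [G(nu) -> d ln 2] and [L] tends to the Gaussian negative log-likelihood, whose
   unique minimizer is [Sigma_hat]. Limits are taken along ultrafilters, which
   replaces the extraction of subsequences. *)

(** * The Gamma function *)

Section GammaFunction.
Context {R : realType}.
Local Notation mu := (@lebesgue_measure R).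
Implicit Types (s t a b : R).

(** The factor [d + nu] is split: the share [d] is spent against [ln |Sigma|] through Hadamard, and
    the share [nu] is left to bound each [delta_i]. Hadamard also produces a term [- d ln nu], which
    cancels the [d ln nu] contained in [G]; only after this cancellation does the pole of Gamma at 0
    decide the case [nu -> 0]. Bounded [delta_i] on [d] independent samples bound [Sigma^-1] only,
    so [Sigma] could still blow up; the upper bound on [ln |Sigma|] prevents it. The limit [d ln 2]
    of [G] is obtained without Stirling's formula: an AM-GM bound squeezes Gamma(s + 1/2) / Gamma(s)
    around the square root of [s], and [d] half-steps telescope. The infimum lives in the extended
    reals and is not bounded below in advance; it is identified with the limit of [L] along an
    ultrafilter. *)

Lemma itvoy_bigcup :
  `]0, +oo[%classic = \bigcup_n `[(n.+2%:R)^-1, n.+2%:R]%classic :> set R.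
Proof.
apply/seteqP; split=> [t|t [n _]] /=; rewrite !in_itv /=; last first.
  by rewrite andbT => /andP[+ _]; apply: lt_le_trans; rewrite invr_gt0.
rewrite andbT => t0.
pose n := Num.truncn (t + t^-1).
exists n => //=; rewrite in_itv /=.
have tn : t + t^-1 < n.+1%:R by rewrite truncnS_gt.
have ti : 0 < t^-1 by rewrite invr_gt0.
have n12 : n.+1%:R <= n.+2%:R :> R by rewrite ler_nat.
apply/andP; split; last lra.
by rewrite invf_ple ?posrE //; lra.
Qed.

Lemma ge0_improper_integral_cvg (f : R -> R) :
  measurable_fun (`]0, +oo[%classic : set (measurableTypeR R)) f -> (forall t, 0 < t -> 0 <= f t) ->
  (\int[mu]_(t in `[(n.+2%:R)^-1%R, n.+2%:R%R]) (f t)%:E)%E @[n --> \oo] -->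
  (\int[mu]_(t in `]0%R, +oo[) (f t)%:E)%E.
Proof.
move=> mf f0; rewrite itvoy_bigcup.
have sub n : `[n.+2%:R^-1, n.+2%:R] `<=` (`]0, +oo[ : set R).
  by rewrite itvoy_bigcup => t tn; exists n.
apply: (@ge0_nondecreasing_set_cvg_integral _ _ R
  (fun n => `[n.+2%:R^-1, n.+2%:R]%classic : set (measurableTypeR R)) (fun t => (f t)%:E) mu).
- apply/nondecreasing_seqP => n; rewrite subsetEset.
  apply: subset_itv; rewrite bnd_simp ?ler_nat //.
  by rewrite lef_pV2 ?posrE ?ler_nat.
- by move=> n; exact: measurable_itv.
- by move=> n; apply/measurable_EFinP; apply: measurable_funS (sub n) mf.
- by move=> n t tn; rewrite lee_fin f0//; have := sub n t tn; rewrite /= in_itv /= andbT.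
Qed.

(** The fundamental theorem of calculus is applied on a nondegenerate interval; this explains
    [n.+2], since [n.+1] would give a single point at [n = 0]. *)
Lemma itv_invn_lt n : (n.+2%:R)^-1 < n.+2%:R :> R.
Proof.
have h : 1 < n.+2%:R :> R by rewrite ltr1n.
by apply: le_lt_trans h; rewrite invf_le1 // ?ltr0n // ler1n.
Qed.

Lemma integral_itv_invn (F f : R -> R) n :
  (forall t, 0 < t -> is_derive t 1 F (f t)) ->
  (forall t, 0 < t -> {for t, continuous f}) ->
  (\int[mu]_(t in `[(n.+2%:R)^-1%R, n.+2%:R%R]) (f t)%:E =
   (F n.+2%:R - F (n.+2%:R)^-1)%:E)%E.
Proof.
move=> dF cf.
have pos t : (n.+2%:R)^-1 <= t -> 0 < t.
  by apply: lt_le_trans; rewrite invr_gt0.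
have cF t : 0 < t -> {for t, continuous F}.
  move=> t0; apply: differentiable_continuous; apply/derivable1_diffP.
  by have [] := dF _ t0.
rewrite (@continuous_FTC2 _ _ F) ?itv_invn_lt //.
- apply: continuous_in_subspaceT => t /set_mem /=.
  by rewrite in_itv /= => /andP[/pos t0 _]; exact: cf.
- split.
  + move=> t; rewrite in_itv /= => /andP[/ltW/pos t0 _].
    by have [] := dF _ t0.
  + by apply: cvg_at_right_filter; apply: cF; apply: pos.
  + by apply: cvg_at_left_filter; apply: cF; rewrite ltr0n.
- move=> t; rewrite in_itv /= => /andP[/ltW/pos t0 _].
  by rewrite derive1E; have [_ ->] := dF _ t0.
Qed.

Lemma continuous_gt0_measurable (f : R -> R) :
  (forall t, 0 < t -> {for t, continuous f}) ->
  measurable_fun (`]0, +oo[%classic : set (measurableTypeR R)) f.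
Proof.
move=> cf; apply: open_continuous_measurable_fun => //.
by move=> t /set_mem /=; rewrite in_itv /= andbT => /cf.
Qed.

Lemma measurable_itvoy :
  measurable (`]0, +oo[%classic : set (measurableTypeR R)).
Proof. exact: measurable_itv. Qed.

(** The integrals of [f] over the exhausting intervals are increments of [F], hence at most [2 B],
    and they increase to the full integral. This gives an integrability test that treats both ends
    of the half-line at once. *)
Lemma integrable_derive_bounded (F f : R -> R) (B : R) :
  (forall t, 0 < t -> is_derive t 1 F (f t)) ->
  (forall t, 0 < t -> {for t, continuous f}) ->
  (forall t, 0 < t -> 0 <= f t) -> (forall t, 0 < t -> `|F t| <= B) ->
  mu.-integrable `]0, +oo[ (EFin \o f).
Proof.
move=> dF cf f0 FB.
have mf := continuous_gt0_measurable cf.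
apply/integrableP; split; first exact/measurable_EFinP.
have -> : (\int[mu]_(t in `]0%R, +oo[) `|(EFin \o f) t| =
           \int[mu]_(t in `]0%R, +oo[) (f t)%:E)%E.
  apply: eq_integral => t /set_mem /=; rewrite in_itv /= andbT => t0.
  by rewrite /= ger0_norm ?f0.
have cv := ge0_improper_integral_cvg mf f0.
apply: (@le_lt_trans _ _ (B + B)%:E); last exact: ltry.
rewrite -(cvg_lim _ cv) //.
apply: lime_le; first by apply/cvg_ex; eexists; exact: cv.
apply: nearW => n; rewrite (integral_itv_invn n dF cf) lee_fin.
have := FB n.+2%:R (ltr0Sn _ _).
have := FB (n.+2%:R)^-1; rewrite invr_gt0 => /(_ (ltr0Sn _ _)).
by rewrite !ler_norml => /andP[? ?] /andP[? ?]; lra.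
Qed.

Lemma continuous_powR s t : 0 < t -> {for t, continuous (fun u => u `^ s)}.
Proof.
move=> t0; apply: differentiable_continuous; apply/derivable1_diffP.
by have [] := is_derive1_powR s t0.
Qed.

Lemma powR_expRN_bounded s : exists B, forall t, 0 < t -> 1 <= t ->
  t `^ s * expR (- t) <= B.
Proof.
pose n := (Num.truncn `|s|).
exists (n.+1`!%:R) => t t0 t1.
rewrite expRN ler_pdivrMr ?expR_gt0 //.
apply: (@le_trans _ _ (t ^+ n.+1)).
  rewrite -powR_mulrn ?(ltW t0) //; apply: ler_powR => //.
  by apply: (le_trans (ler_norm s)); apply: ltW; rewrite truncnS_gt.
have := expR_ge1Dxn n (ltW t0).
have f0 : 0 < n.+1`!%:R :> R by rewrite ltr0n fact_gt0.
by rewrite -ler_pdivrMl // mulrC => h; lra.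
Qed.

Lemma powRD_gt0 t a b : 0 < t -> t `^ (a + b) = t `^ a * t `^ b.
Proof. by move=> t0; rewrite powRD // (gt_eqF t0) implybT. Qed.

Definition gamma_fun s t := t `^ (s - 1) * expR (- t).

Lemma gamma_fun_gt0 s t : 0 < t -> 0 < gamma_fun s t.
Proof. by move=> t0; rewrite mulr_gt0 ?powR_gt0 ?expR_gt0. Qed.

Lemma continuous_gamma_fun s t : 0 < t -> {for t, continuous (gamma_fun s)}.
Proof.
move=> t0; apply: continuousM; first exact: continuous_powR.
apply: continuous_comp; first exact: continuousN.
exact: continuous_expR.
Qed.

Lemma expRN_powR_bounded s : 0 < s -> exists C, forall t, 0 < t ->
  expR (- t) * (1 + t `^ s) ^+ 2 <= C.
Proof.
move=> s0; have [B hB] := powR_expRN_bounded (s * 2).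
exists (4 + 4 * `|B|) => t t0.
have e1 : expR (- t) <= 1 by rewrite expR_le1; lra.
have e0 := expR_gt0 (- t).
have p0 := powR_gt0 s t0.
have [t1|t1] := lerP t 1.
  have p1 : t `^ s <= 1.
    suff: t `^ s <= 1 `^ s by rewrite powR1.
    by apply: ge0_ler_powR; rewrite ?nnegrE ?(ltW s0) ?(ltW t0) ?ler01 ?(ltW t1).
  have : (1 + t `^ s) ^+ 2 <= 4 by nra.
  have := normr_ge0 B; nra.
have p1 : 1 <= t `^ s.
  suff: 1 `^ s <= t `^ s by rewrite powR1.
  by apply: ge0_ler_powR; rewrite ?nnegrE ?(ltW s0) ?(ltW t0) ?ler01 ?(ltW t1).
have := hB t t0 (ltW t1); rewrite powRrM powR_mulrn ?powR_ge0 // => h.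
have h2 := ler_norm B.
have h3 : (1 + t `^ s) ^+ 2 <= 4 * t `^ s ^+ 2 by nra.
apply: (@le_trans _ _ (expR (- t) * (4 * t `^ s ^+ 2))).
  by rewrite ler_pM2l.
lra.
Qed.

Lemma integrable_gamma_fun s : 0 < s ->
  mu.-integrable `]0, +oo[ (EFin \o gamma_fun s).
Proof.
move=> s0; have [C hC] := expRN_powR_bounded s0.
pose g t := (1 + t `^ s) ^- 2 * (s * t `^ (s - 1)).
have p1 t : 0 < t -> 1 + t `^ s != 0.
  by move=> t0; rewrite gt_eqF // addr_gt0 ?powR_gt0.
have dF t : 0 < t -> is_derive t 1 (fun u => - (1 + u `^ s)^-1) (g t).
  move=> t0; have := is_derive1_powR s t0 => ?.
  have h : is_derive t 1 (fun u => 1 + u `^ s) (0 + s * t `^ (s - 1)).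
    exact: is_deriveD.
  have := @is_deriveV R (fun u => 1 + u `^ s) _ _ _ (p1 t t0) h.
  move=> /is_deriveN H.
  apply: is_derive_eq H _.
  by rewrite /g add0r scaleNr opprK.
have cg t : 0 < t -> {for t, continuous g}.
  move=> t0; apply: continuousM; last first.
    by apply: continuousM; [exact: cvg_cst | exact: continuous_powR].
  apply: continuousV; first by rewrite expf_neq0 ?p1.
  apply: (@continuous_comp _ _ _ (fun u => 1 + u `^ s) (fun v => v ^+ 2));
    last exact: exprn_continuous.
  apply: continuousD; first exact: cvg_cst.
  exact: continuous_powR.
have g0 t : 0 < t -> 0 <= g t.
  move=> t0; rewrite /g mulr_ge0 //; last by rewrite mulr_ge0 ?powR_ge0 ?ltW.
  by rewrite invr_ge0 exprn_ge0 // addr_ge0 ?powR_ge0.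
have FB t : 0 < t -> `|- (1 + t `^ s)^-1| <= 1.
  move=> t0; have := powR_gt0 s t0 => ?.
  rewrite normrN ger0_norm ?invr_ge0 ?addr_ge0 ?powR_ge0 //.
  by rewrite invf_le1; lra.
have ig := integrable_derive_bounded dF cg g0 FB.
have := integrableZl measurable_itvoy (C / s) ig.
apply: (le_integrable measurable_itvoy).
  apply/measurable_EFinP; apply: continuous_gt0_measurable.
  by move=> t; exact: continuous_gamma_fun.
move=> t /=; rewrite in_itv /= andbT => t0.
rewrite lee_fin.
rewrite ger0_norm ?(ltW (gamma_fun_gt0 _ _)) //.
apply: le_trans (ler_norm _).
rewrite /gamma_fun /g.
have := hC t t0.
rewrite -ler_pdivlMr ?exprn_gt0 ?addr_gt0 ?powR_gt0 // => h.
have -> : C / s * ((1 + t `^ s) ^- 2 * (s * t `^ (s - 1))) =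
   t `^ (s - 1) * (C / (1 + t `^ s) ^+ 2).
  by field; rewrite p1 // gt_eqF.
by rewrite ler_pM2l ?powR_gt0.
Qed.

Lemma Gamma_gt0 s : 0 < s -> 0 < Gamma s.
Proof.
move=> s0; have fi := integrable_gamma_fun s0.
have /measurable_EFinP mf := measurable_int _ fi.
have -> : Gamma s = fine (\int[mu]_(t in `]0%R, +oo[) (gamma_fun s t)%:E)%E by [].
apply: fine_gt0; apply/andP; split; last first.
  by move/integrable_lty : fi; exact.
have s12 : `[1, 2] `<=` (`]0, +oo[ : set R).
  by move=> t /=; rewrite !in_itv /= andbT => /andP[+ _]; exact: lt_le_trans.
(* On [[1, 2]] the power is at least [t^-1 >= 1 / 2], because [s - 1 > -1], and the exponential is
   at least [expR (- 2)]. *)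
pose c : R := expR (- 2) / 2.
have c0 : 0 < c by rewrite divr_gt0 ?expR_gt0.
have m12 : measurable (`[1, 2]%classic : set (measurableTypeR R)).
  exact: measurable_itv.
apply: (@lt_le_trans _ _ (\int[mu]_(t in `[1%R, 2%R]) c%:E)%E).
  rewrite integral_cst //= lebesgue_measure_itv /= lte_fin ltr1n.
  by rewrite -EFinB -EFinM lte_fin mulr_gt0 // subr_gt0 ltr1n.
apply: (@le_trans _ _ (\int[mu]_(t in `[1%R, 2%R]) (gamma_fun s t)%:E)%E).
  apply: ge0_le_integral => //.
  - by move=> t _; rewrite lee_fin ltW.
  - by apply/measurable_EFinP; apply: measurable_funS mf.
  - move=> t /=; rewrite in_itv /= lee_fin => /andP[t1 t2].
    rewrite /c /gamma_fun mulrC; apply: ler_pM; rewrite ?invr_ge0 ?expR_ge0 //.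
      apply: (@le_trans _ _ (t `^ (-1))); last by apply: ler_powR => //; lra.
      by rewrite powR_inv1 ?(le_trans ler01) // lef_pV2 ?posrE; lra.
    by rewrite ler_expR lerN2.
apply: ge0_subset_integral => //; first exact/measurable_EFinP.
by move=> t /=; rewrite in_itv /= andbT lee_fin => t0; rewrite ltW ?gamma_fun_gt0.
Qed.

Lemma is_derive_powR_expRN s t : 0 < t ->
  is_derive t 1 (fun u => u `^ s * expR (- u))
    (s * gamma_fun s t - gamma_fun (s + 1) t).
Proof.
move=> t0; have ? := is_derive1_powR s t0.
apply: is_derive_eq.
by rewrite /gamma_fun addrK /GRing.scale /=; ring.
Qed.

(** These are the boundary terms of the integration by parts behind [GammaD1]. *)
Lemma powR_expRN_cvg0 s : 0 < s ->
  (n.+2%:R `^ s * expR (- n.+2%:R) - (n.+2%:R^-1) `^ s * expR (- n.+2%:R^-1))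
    @[n --> \oo] --> (0 : R).
Proof.
move=> s0.
have hinv : (n.+2%:R : R)^-1 @[n --> \oo] --> (0 : R).
  by have := @cvg_harmonic R; rewrite -cvg_shiftS.
rewrite -[X in _ --> X]subr0; apply: cvgB.
  (* One power more than needed is bounded; dividing it out leaves a bound [B / (n + 2)] that tends
     to 0. *)
  have [B hB] := powR_expRN_bounded (s + 1).
  apply: (@squeeze_cvgr _ _ _ _ (fun=> 0) (fun n => B * (n.+2%:R)^-1)).
  - apply: nearW => n; have n0 : 0 < n.+2%:R :> R by rewrite ltr0n.
    rewrite mulr_ge0 ?powR_ge0 ?expR_ge0 //= ler_pdivlMr //.
    apply: le_trans (hB n.+2%:R n0 _); last by rewrite ler1n.
    rewrite mulrAC powRD; last by rewrite pnatr_eq0 implybT.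
    by rewrite powRr1.
  - exact: cvg_cst.
  - by rewrite -[X in _ --> X](mulr0 B); apply: cvgM => //; exact: cvg_cst.
apply: (@squeeze_cvgr _ _ _ _ (fun=> 0) (fun n => (n.+2%:R^-1) `^ s)).
- apply: nearW => n; rewrite mulr_ge0 ?powR_ge0 ?expR_ge0 //=.
  by rewrite ler_piMr ?powR_ge0 // expR_le1 oppr_le0 invr_ge0.
- exact: cvg_cst.
- have /cvg_at_rightP := powR_cvg0 s0; apply.
  by split => // n; rewrite invr_gt0.
Qed.

Lemma Gamma_improper_cvg s : 0 < s ->
  \int[mu]_(t in `[(n.+2%:R)^-1, n.+2%:R]) gamma_fun s t @[n --> \oo] -->
  Gamma s.
Proof.
move=> s0; have fi := integrable_gamma_fun s0.
have /measurable_EFinP mf := measurable_int _ fi.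
apply: fine_cvg; rewrite fineK; last exact: integrable_fin_num fi.
by apply: ge0_improper_integral_cvg => // t t0; rewrite ltW ?gamma_fun_gt0.
Qed.

(** The derivative of [t^s e^-t] is the difference of the two integrands, so on each exhausting
    interval the difference of the integrals is a boundary term. *)
Lemma GammaD1 s : 0 < s -> Gamma (s + 1) = s * Gamma s.
Proof.
move=> s0; have s10 : 0 < s + 1 by rewrite addr_gt0.
pose I n := (`[(n.+2%:R)^-1, n.+2%:R]%classic : set (measurableTypeR R)).
have mI n : measurable (I n) by exact: measurable_itv.
have sI n : I n `<=` `]0, +oo[ by rewrite itvoy_bigcup => t tn; exists n.
have fi u n : 0 < u -> mu.-integrable (I n) (EFin \o gamma_fun u).
  move=> u0; apply: integrableS (integrable_gamma_fun u0) => //.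
have cf u t : 0 < t -> {for t, continuous (gamma_fun u)}.
  exact: continuous_gamma_fun.
have A := Gamma_improper_cvg s0; have B := Gamma_improper_cvg s10.
have AB : s * (\int[mu]_(t in I n) gamma_fun s t) -
    (\int[mu]_(t in I n) gamma_fun (s + 1) t) @[n --> \oo] -->
    s * Gamma s - Gamma (s + 1).
  by apply: cvgB B; apply: cvgM => //; exact: cvg_cst.
have E n : s * (\int[mu]_(t in I n) gamma_fun s t) -
    (\int[mu]_(t in I n) gamma_fun (s + 1) t) =
    n.+2%:R `^ s * expR (- n.+2%:R) - (n.+2%:R^-1) `^ s * expR (- n.+2%:R^-1).
  rewrite -RintegralZl ?fi // -RintegralB ?fi //; last first.
    exact: (integrableZl (mI n) s (fi s n s0)).
  rewrite /Rintegral (integral_itv_invn n (@is_derive_powR_expRN s)) //.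
  move=> t t0; apply: continuousB; last exact: cf.
  by apply: continuousM; [exact: cvg_cst | exact: cf].
rewrite (funext E) in AB; have := cvg_unique _ AB (powR_expRN_cvg0 s0).
by move=> /(_ (@Rhausdorff R) _)/eqP; rewrite subr_eq0 => /eqP.
Qed.

(* AM-GM: [t^(s-1/2) <= t^(s-1) (t / c + c) / 2] with [c = sqrt s]. *)
Lemma Gamma_half_le s : 0 < s -> Gamma (s + 2^-1) ^+ 2 <= s * Gamma s ^+ 2.
Proof.
move=> s0; have sh0 : 0 < s + 2^-1 by lra.
have s10 : 0 < s + 1 by lra.
pose c := Num.sqrt s; have c0 : 0 < c by rewrite sqrtr_gt0.
have c2 : c ^+ 2 = s by rewrite sqr_sqrtr ?ltW.
have fi := integrable_gamma_fun s0; have fi1 := integrable_gamma_fun s10.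
have fz := integrableZl measurable_itvoy (c / 2) fi.
have fz1 := integrableZl measurable_itvoy (c^-1 / 2) fi1.
have le t : 0 < t -> gamma_fun (s + 2^-1) t <=
    c^-1 / 2 * gamma_fun (s + 1) t + c / 2 * gamma_fun s t.
  move=> t0; rewrite /gamma_fun.
  have -> : t `^ (s + 2^-1 - 1) = t `^ (s - 1) * Num.sqrt t.
    rewrite -(powR12_sqrt (ltW t0)) -powRD_gt0 //.
    by congr (_ `^ _); lra.
  have -> : t `^ (s + 1 - 1) = t `^ (s - 1) * Num.sqrt t ^+ 2.
    rewrite sqr_sqrtr ?ltW // -[X in _ * X]powRr1 ?ltW // -powRD_gt0 //.
    by congr (_ `^ _); lra.
  set q := Num.sqrt t.
  have h : q <= c^-1 / 2 * q ^+ 2 + c / 2.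
    rewrite -subr_ge0.
    have -> : c^-1 / 2 * q ^+ 2 + c / 2 - q = (q - c) ^+ 2 / (2 * c).
      by field; rewrite gt_eqF.
    by rewrite divr_ge0 ?sqr_ge0 // mulr_ge0 // ltW.
  have p : 0 < t `^ (s - 1) * expR (- t) by rewrite mulr_gt0 ?powR_gt0 ?expR_gt0.
  have := ler_wpM2l (ltW p) h; lra.
have : Gamma (s + 2^-1) <= c^-1 / 2 * Gamma (s + 1) + c / 2 * Gamma s.
  rewrite -!RintegralZl // -RintegralD //.
  apply: le_Rintegral => //.
  - exact: integrable_gamma_fun.
  - exact: (integrableD measurable_itvoy fz1 fz).
  - by move=> t /=; rewrite in_itv /= andbT => /le.
have cs : c^-1 * s = c by rewrite -[X in _ * X]c2; field; rewrite gt_eqF.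
rewrite GammaD1 // => h.
have {}h : Gamma (s + 2^-1) <= c * Gamma s.
  apply: le_trans h _; rewrite mulrA [c^-1 / 2 * s]mulrAC cs; lra.
rewrite -[X in X * _]c2 -exprMn; apply: lerXn2r => //.
  by rewrite nnegrE ltW ?Gamma_gt0.
by rewrite nnegrE mulr_ge0 ?ltW ?Gamma_gt0.
Qed.

(** The inequality [ln y < y] at [y = t^e] and [y = t^-e]. It trades the logarithm that
    differentiation in [s] brings out for powers, which only shift the exponent of [gamma_fun]. *)
Lemma normr_ln_le t e : 0 < t -> 0 < e -> `|ln t| <= (t `^ e + t `^ (- e)) / e.
Proof.
move=> t0 e0; rewrite ler_pdivlMr // -(gtr0_norm e0) -normrM (gtr0_norm e0).
have := ln_sublinear (powR_gt0 e t0); have := ln_sublinear (powR_gt0 (- e) t0).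
rewrite !ln_powR => h1 h2.
have := powR_gt0 e t0; have := powR_gt0 (- e) t0 => h3 h4.
by rewrite ler_norml; apply/andP; split; lra.
Qed.

Lemma powR_le_sum t a b s : 0 < t -> a <= s -> s <= b ->
  t `^ s <= t `^ a + t `^ b.
Proof.
move=> t0 as_ sb; have [t1|t1] := lerP 1 t.
  by apply: (le_trans (ler_powR t1 sb)); rewrite lerDr powR_ge0.
apply: (@le_trans _ _ (t `^ a)); last by rewrite lerDl powR_ge0.
by apply: ger_powR; rewrite // t0 ltW.
Qed.

Lemma gamma_fun_powRM s e t : 0 < t -> t `^ e * gamma_fun s t = gamma_fun (s + e) t.
Proof.
move=> t0; rewrite /gamma_fun mulrA -powRD_gt0 //.
by congr (_ `^ _ * _); lra.
Qed.

Lemma is_derive_gamma_fun s t : 0 < t ->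
  is_derive s 1 (gamma_fun ^~ t) (ln t * gamma_fun s t).
Proof.
move=> t0.
have -> : gamma_fun ^~ t = (fun u => expR (- t) * expR ((u - 1) * ln t)).
  by apply/funext => u; rewrite /gamma_fun /powR gt_eqF // mulrC.
apply: is_derive_eq.
rewrite /gamma_fun /powR gt_eqF // /GRing.scale /=; ring.
Qed.

Lemma derivable_Gamma s : 0 < s -> derivable (@Gamma R) s 1.
Proof.
move=> s0.
(* The domination has to be uniform over exponents in []u, v[]; the logarithm costs a shift by [e]
   in either direction, and [e = s / 4] keeps the smallest exponent [u - e] positive. *)
pose e := s / 4; pose u := s / 2; pose v := s * 2.
have e0 : 0 < e by rewrite /e; lra.
pose H t := gamma_fun (u - e) t + gamma_fun (u + e) t
          + gamma_fun (v - e) t + gamma_fun (v + e) t.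
have iH : mu.-integrable `]0, +oo[ (EFin \o (fun t => e^-1 * H t)).
  have i1 : 0 < u - e by rewrite /u /e; lra.
  have i2 : 0 < u + e by rewrite /u /e; lra.
  have i3 : 0 < v - e by rewrite /v /e; lra.
  have i4 : 0 < v + e by rewrite /v /e; lra.
  exact: (integrableZl measurable_itvoy e^-1 (integrableD measurable_itvoy
    (integrableD measurable_itvoy (integrableD measurable_itvoy
    (integrable_gamma_fun i1) (integrable_gamma_fun i2))
    (integrable_gamma_fun i3)) (integrable_gamma_fun i4))).
have g0 r t : 0 <= gamma_fun r t by rewrite mulr_ge0 ?powR_ge0 ?expR_ge0.
apply: (@derivable_under_integral R _ _ mu gamma_fun `]0, +oo[
  measurable_itvoy s u v _ _ _ (fun t => e^-1 * H t)) => //.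
- by rewrite /= in_itv /= /u /v; apply/andP; split; lra.
- move=> r /=; rewrite in_itv /= => /andP[ur _].
  by apply: integrable_gamma_fun; apply: lt_trans ur; rewrite /u; lra.
- move=> r t _ /=; rewrite in_itv /= andbT => t0.
  by have [] := is_derive_gamma_fun r t0.
- by move=> t; rewrite mulr_ge0 ?invr_ge0 ?(ltW e0) // /H !addr_ge0.
move=> r t /=; rewrite !in_itv /= andbT => /andP[ur rv] t0.
rewrite partial1of2E; have [_ ->] := is_derive_gamma_fun r t0.
rewrite normrM (ger0_norm (g0 _ _)).
apply: (@le_trans _ _ ((t `^ e + t `^ (- e)) / e * (gamma_fun u t + gamma_fun v t))).
  apply: ler_pM => //; first exact: normr_ln_le.
  rewrite -mulrDl ler_wpM2r ?expR_ge0 //.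
  by apply: powR_le_sum => //; lra.
rewrite /H -!gamma_fun_powRM //; rewrite le_eqVlt; apply/orP; left; apply/eqP; ring.
Qed.

End GammaFunction.

(** * Positive definite matrices *)

Section PositiveDefinite.
Context {R : realType}.

Lemma ln_prod (I : finType) (F : I -> R) : (forall i, 0 < F i) ->
  ln (\prod_i F i) = \sum_i ln (F i).
Proof.
move=> F0; suff [] : 0 < \prod_i F i /\ ln (\prod_i F i) = \sum_i ln (F i) by [].
elim/big_ind2 : _ => [|a b a' b' [a0 <-] [a'0 <-]|i _]; rewrite ?ln1 //.
by rewrite mulr_gt0 // lnM.
Qed.

Lemma trmx_mul_col d (u : 'cV[R]_d) :
  (u^T *m u) ord0 ord0 = \sum_i u i ord0 ^+ 2.
Proof. by rewrite mxE; apply: eq_bigr => i _; rewrite mxE expr2. Qed.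

Lemma trmx_mul_col_gt0 d (u : 'cV[R]_d) : u != 0 -> 0 < (u^T *m u) ord0 ord0.
Proof.
move=> u0; rewrite trmx_mul_col lt_neqAle sumr_ge0 ?andbT; last first.
  by move=> i _; exact: sqr_ge0.
rewrite eq_sym; apply: contra u0 => /eqP/psumr_eq0P h.
apply/eqP/colP => i; rewrite mxE; apply/eqP.
by rewrite -sqrf_eq0 h // => j _; exact: sqr_ge0.
Qed.

Lemma SPD_mulmx_tr d (Y : 'M[R]_d) : Y \in unitmx -> SPD (Y *m Y^T).
Proof.
move=> Yu; split; first by rewrite trmx_mul trmxK.
move=> v v0; rewrite mulmxA -[Y in v^T *m Y]trmxK -trmx_mul -mulmxA.
apply: trmx_mul_col_gt0; apply: contra v0 => /eqP h.
by rewrite -[v]mul1mx -(mulVmx (_ : Y^T \in unitmx)) ?unitmx_tr // -mulmxA h mulmx0.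
Qed.

Lemma cholesky d (A : 'M[R]_d) : SPD A ->
  exists L : 'M[R]_d, [/\ is_trig_mx L, forall i, 0 < L i i & A = L *m L^T].
Proof.
elim: d A => [|d IH] A [As Ap].
  exists 0; split; [exact: mx0_is_trig | by case | by apply/matrixP; case].
move: A As Ap; rewrite -[d.+1]/(1 + d)%N => A As Ap.
pose a := A ord0 ord0; pose b := dlsubmx A; pose D := drsubmx A.
have Ab : A = block_mx a%:M b^T b D.
  rewrite -[A]submxK; congr block_mx.
    by apply/matrixP => i j; rewrite !ord1 !mxE eqxx mulr1n; congr (A _ _); apply: val_inj.
  by rewrite /b trmx_dlsub As.
have Ds : D^T = D by rewrite /D trmx_drsub As.
have a0 : 0 < a.
  pose u : 'cV[R]_(1 + d) := delta_mx ord0 ord0.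
  have := Ap u; rewrite trmx_delta -rowE.
  have -> : (row ord0 A *m u) ord0 ord0 = a by rewrite -colE !mxE.
  apply; apply/eqP => /matrixP/(_ ord0 ord0); rewrite !mxE !eqxx => /eqP.
  by rewrite oner_eq0.
(* The Schur complement of the corner [a]. It inherits positivity because, for given [v], the first
   block of the test vector below minimizes the quadratic form of [A], with minimum [v^T S v]. *)
pose S := D - a^-1 *: (b *m b^T).
have SS : SPD S.
  split; first by rewrite /S linearB /= linearZ /= trmx_mul trmxK Ds.
  move=> v v0; have := Ap (col_mx (- a^-1 *: (b^T *m v)) v).
  have -> : ((col_mx (- a^-1 *: (b^T *m v)) v)^T *m A *m
             col_mx (- a^-1 *: (b^T *m v)) v) = v^T *m S *m v.
    rewrite Ab -mulmxA mul_block_col tr_col_mx mul_row_col.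
    rewrite mul_scalar_mx scalerA mulrN mulfV ?gt_eqF // scaleN1r addNr mulmx0 add0r.
    rewrite -scalemxAr mulmxDr -scalemxAr scaleNr addrC.
    by rewrite /S mulmxBr mulmxBl -scalemxAr -scalemxAl !mulmxA.
  by apply; rewrite col_mx_eq0 negb_and v0 orbT.
have [L [Lt Lp SL]] := IH S SS.
pose r := Num.sqrt a; have r0 : 0 < r by rewrite sqrtr_gt0.
have r2 : r * r = a by rewrite -expr2 sqr_sqrtr ?ltW.
exists (block_mx r%:M 0 (r^-1 *: b) L); split.
- by rewrite is_trig_block_mx // eqxx Lt /= scalar_mx_is_trig.
- move=> i; case: (split_ordP i) => j ->.
    by rewrite block_mxEul !mxE eqxx mulr1n.
  by rewrite block_mxEdr.
- rewrite Ab tr_block_mx mulmx_block trmx0 !mul0mx !mulmx0 !addr0.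
  congr block_mx.
  + by rewrite tr_scalar_mx -scalar_mxM r2.
  + by rewrite linearZ /= mul_scalar_mx scalerA mulfV ?scale1r ?gt_eqF.
  + by rewrite tr_scalar_mx mul_mx_scalar scalerA mulfV ?scale1r ?gt_eqF.
  + rewrite -SL linearZ /= -scalemxAl -scalemxAr scalerA -invfM r2 /S.
    by rewrite addrC subrK.
Qed.

Lemma trig_gt0_unitmx d (L : 'M[R]_d) :
  is_trig_mx L -> (forall i, 0 < L i i) -> 0 < \det L /\ L \in unitmx.
Proof.
move=> Lt Lp; have : 0 < \det L by rewrite det_trig // prodr_gt0.
by move=> L0; split => //; rewrite unitmxE unitfE gt_eqF.
Qed.

Lemma SPD_factor d (A : 'M[R]_d) : SPD A ->
  exists2 L : 'M[R]_d, L \in unitmx & A = L *m L^T.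
Proof.
by move=> /cholesky[L [Lt Lp ->]]; exists L => //; have [] := trig_gt0_unitmx Lt Lp.
Qed.

Lemma SPD_det_gt0 d (A : 'M[R]_d) : SPD A -> 0 < \det A.
Proof.
move=> /SPD_factor[L Lu ->]; rewrite det_mulmx det_tr -expr2.
by rewrite exprn_even_gt0 //= -unitfE -unitmxE.
Qed.

Lemma SPD_unitmx d (A : 'M[R]_d) : SPD A -> A \in unitmx.
Proof. by move=> /SPD_det_gt0 A0; rewrite unitmxE unitfE gt_eqF. Qed.

Lemma SPD_congr d (X A : 'M[R]_d) : X \in unitmx -> SPD A -> SPD (X^T *m A *m X).
Proof.
move=> Xu /SPD_factor[L Lu ->].
have -> : X^T *m (L *m L^T) *m X = (X^T *m L) *m (X^T *m L)^T.
  by rewrite trmx_mul trmxK !mulmxA.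
by apply: SPD_mulmx_tr; rewrite unitmx_mul unitmx_tr Xu.
Qed.

Lemma invmx_mul d (A B : 'M[R]_d) : A \in unitmx -> B \in unitmx ->
  invmx (A *m B) = invmx B *m invmx A.
Proof.
move=> Au Bu; have ABu : A *m B \in unitmx by rewrite unitmx_mul Au.
apply: (can_inj (mulKmx ABu)).
by rewrite mulmxV // mulmxA -[A *m B *m _]mulmxA mulmxV // mulmx1 mulmxV.
Qed.

Lemma invmx_mulmx_tr d (L : 'M[R]_d) : L \in unitmx ->
  invmx (L *m L^T) = (invmx L)^T *m invmx L.
Proof. by move=> Lu; rewrite invmx_mul ?unitmx_tr // trmx_inv. Qed.

Lemma SPD_invmx d (A : 'M[R]_d) : SPD A -> SPD (invmx A).
Proof.
move=> /SPD_factor[L Lu ->]; rewrite invmx_mulmx_tr //.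
by rewrite -[X in _ *m X]trmxK; apply: SPD_mulmx_tr; rewrite unitmx_tr unitmx_inv.
Qed.

Lemma mulmx_tr_diag d (L : 'M[R]_d) i : (L *m L^T) i i = \sum_j L i j ^+ 2.
Proof. by rewrite mxE; apply: eq_bigr => j _; rewrite mxE expr2. Qed.

Lemma mulmx_tr_entry_le d (L : 'M[R]_d) i j : L i j ^+ 2 <= (L *m L^T) i i.
Proof.
rewrite mulmx_tr_diag (bigD1 j) //= lerDl sumr_ge0 // => k _.
exact: sqr_ge0.
Qed.

(** In a Cholesky factorization, [A i i] is the sum of squares of row [i] of [L], whereas the
    determinant multiplies the squared diagonal entries alone. *)
Lemma hadamard d (A : 'M[R]_d) : SPD A -> \det A <= \prod_i A i i.
Proof.
move=> /cholesky[L [Lt Lp ->]].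
rewrite det_mulmx det_tr det_trig // -big_split /=.
apply: ler_prod => i _; rewrite -expr2 sqr_ge0 /=.
exact: mulmx_tr_entry_le.
Qed.

(* With [M = L L^T] triangular, [tr M - ln det M - d] is the sum of the
   [L_ii^2 - 1 - ln L_ii^2] and of the squared off-diagonal entries. *)
Lemma ln_det_le_trace d (M : 'M[R]_d) : SPD M ->
  ln (\det M) <= \tr M - d%:R /\ (ln (\det M) = \tr M - d%:R -> M = 1%:M).
Proof.
move=> /cholesky[L [Lt Lp ->]].
have L2 i : 0 < L i i ^+ 2 by rewrite exprn_gt0.
have lnd : ln (\det (L *m L^T)) = \sum_i ln (L i i ^+ 2).
  rewrite det_mulmx det_tr det_trig // -big_split /=.
  by under eq_bigr do rewrite -expr2; rewrite ln_prod.
pose g i : R := L i i ^+ 2 - 1 - ln (L i i ^+ 2) + \sum_(j | j != i) L i j ^+ 2.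
have trE : \tr (L *m L^T) - d%:R - ln (\det (L *m L^T)) = \sum_i g i.
  rewrite lnd /mxtrace -[d in d%:R]card_ord -sum1_card natr_sum -!sumrB.
  by apply: eq_bigr => i _; rewrite mulmx_tr_diag (bigD1 i) //= /g; ring.
have h1 i : 0 <= L i i ^+ 2 - 1 - ln (L i i ^+ 2).
  have : ln (1 + (L i i ^+ 2 - 1)) <= L i i ^+ 2 - 1.
    by apply: le_ln1Dx; have := L2 i; lra.
  by rewrite [1 + _]addrC subrK; lra.
have h2 i : 0 <= \sum_(j | j != i) L i j ^+ 2.
  by apply: sumr_ge0 => j _; exact: sqr_ge0.
have g0 i : 0 <= g i by rewrite addr_ge0.
split; first by rewrite -subr_ge0 trE sumr_ge0.
move=> /eqP; rewrite eq_sym -subr_eq0 trE => /eqP/psumr_eq0P h.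
have gi i : g i = 0 by apply: h => // j _.
suff -> : L = 1%:M by rewrite mul1mx trmx1.
apply/matrixP => i j; rewrite mxE.
have g1 : L i i ^+ 2 - 1 - ln (L i i ^+ 2) = 0.
  by apply/eqP; have := gi i; rewrite /g => /eqP; rewrite paddr_eq0 // => /andP[].
have g2 : \sum_(j | j != i) L i j ^+ 2 = 0.
  by apply/eqP; have := gi i; rewrite /g => /eqP; rewrite paddr_eq0 // => /andP[].
have [<-|ij] := eqVneq i j; last first.
  move/psumr_eq0P : g2 => /(_ (fun k _ => sqr_ge0 _) j).
  by rewrite eq_sym => /(_ ij)/eqP; rewrite sqrf_eq0 => /eqP.
have : L i i ^+ 2 = 1.
  apply/eqP; rewrite -subr_eq0; apply: contraT => n0.
  have l0 : ln (L i i ^+ 2) != 0 by rewrite ln_eq0 // -subr_eq0.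
  have := expR_gt1Dx l0; rewrite lnK ?posrE //; lra.
move=> /eqP; rewrite sqrf_eq1 => /orP[/eqP //|/eqP hN].
by have := Lp i; rewrite hN; lra.
Qed.

(** Nonnegativity, with its equality case, of twice the Kullback-Leibler divergence between centered
    Gaussians. With [T = C C^T], the symmetric [M = C^T S^-1 C] has the trace and determinant of
    [S^-1 T], which reduces the claim to [ln_det_le_trace]. *)
Lemma gauss_divergence d (S T : 'M[R]_d) : SPD S -> SPD T ->
  d%:R + ln (\det T) <= \tr (invmx S *m T) + ln (\det S) /\
  (\tr (invmx S *m T) + ln (\det S) <= d%:R + ln (\det T) -> S = T).
Proof.
move=> SS ST; have [C Cu TC] := SPD_factor ST.
have Ss := SPD_det_gt0 SS; have Ts := SPD_det_gt0 ST.
pose M := C^T *m invmx S *m C.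
have SM : SPD M by apply: SPD_congr => //; exact: SPD_invmx.
have [h1 h2] := ln_det_le_trace SM.
have trM : \tr M = \tr (invmx S *m T).
  by rewrite /M TC -mulmxA mxtrace_mulC !mulmxA.
have dM : ln (\det M) = ln (\det T) - ln (\det S).
  rewrite -ln_div ?posrE // /M !det_mulmx det_tr det_inv TC det_mulmx det_tr.
  by rewrite mulrAC.
split; first lra.
move=> h3; have {}/h2 M1 : ln (\det M) = \tr M - d%:R by lra.
suff : invmx S = invmx T by move=> /(congr1 invmx); rewrite !invmxK.
rewrite TC invmx_mulmx_tr // trmx_inv -[LHS]mulmx1 -{1}(mulmxV Cu) -[invmx S]mul1mx.
rewrite -(mulVmx (_ : C^T \in unitmx)) ?unitmx_tr // !mulmxA.
by rewrite -[_ *m C^T *m _]mulmxA -[_ *m (C^T *m _) *m _]mulmxA -/M M1 mulmx1.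
Qed.

(** * Extremal weights and independent samples *)

Lemma exists_smallest_subset n k (y : 'I_n -> R) : (k <= n)%N ->
  exists I : {set 'I_n}, #|I| = k /\
    forall i j, i \in I -> j \notin I -> y i <= y j.
Proof.
elim: k => [|k IH] kn.
  by exists finset.set0; split => [|i j]; rewrite ?cards0 // inE.
have [I [cI hI]] := IH (ltnW kn).
have [i0 i0I] : exists i0, i0 \notin I.
  apply/existsP; rewrite -negb_forall; apply/negP => /forallP h.
  have : I = [set: 'I_n]%SET by apply/setP => i; rewrite inE; exact: h.
  by move=> IT; move: kn; rewrite -cI IT cardsT card_ord ltnn.
case: (@arg_minP _ _ _ i0 (fun i => i \notin I) y i0I) => m mI hm.
exists (m |: I)%SET; split; first by rewrite cardsU1 mI cI.
move=> i j; rewrite !inE negb_or => /orP[/eqP -> /andP[_ /hm //]|iI /andP[_ jI]].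
exact: hI.
Qed.

(* The weights [d w_i] are in [0, 1] and sum to [d]; over such weights the
   weighted sum of the [y_i] is smallest for the indicator of the [d] smallest
   [y_i]. *)
Lemma weighted_sum_ge_subset d n (w y : 'I_n -> R) : (0 < d)%N ->
  (forall i, 0 <= w i) -> (forall i, d%:R * w i <= 1) -> \sum_i w i = 1 ->
  exists2 I : {set 'I_n}, #|I| = d &
    \sum_(i in I) y i <= d%:R * \sum_i w i * y i.
Proof.
move=> d0 w0 w1 ws.
have dn : (d <= n)%N.
  have : \sum_i d%:R * w i <= \sum_(i < n) 1 by exact: ler_sum.
  by rewrite -mulr_sumr ws mulr1 sumr_const card_ord ler_nat.
have [I [cI hI]] := exists_smallest_subset y dn.
exists I => //.
have [i0 i0I] : exists i, i \in I by apply/set0Pn; rewrite -card_gt0 cI.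
case: (@arg_maxP _ _ _ i0 (fun i => i \in I) y i0I) => m mI hm.
have c1 : \sum_i (if i \in I then 1 else 0 : R) = d%:R.
  by rewrite -big_mkcond /= sumr_const cI.
have c0 : \sum_i (d%:R * w i - (if i \in I then 1 else 0)) = 0.
  by rewrite sumrB -mulr_sumr ws mulr1 c1 subrr.
have h : \sum_(i in I) y i = \sum_i (if i \in I then 1 else 0) * y i.
  by rewrite big_mkcond /=; apply: eq_bigr => i _; case: ifP; rewrite ?mul1r ?mul0r.
(* Here [y m] is the largest value on [I], so the two factors have the same sign in and out of [I].
   Subtracting it is free because the first factors sum to 0 by [c0]. *)
have key : 0 <= \sum_i (d%:R * w i - (if i \in I then 1 else 0)) * (y i - y m).
  apply: sumr_ge0 => i _; case: ifPn => iI.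
    by have /= := hm i iI; have := w1 i => ? ?; rewrite mulr_le0 //; lra.
  by have := hI _ _ mI iI => ?; rewrite subr0 !mulr_ge0 // subr_ge0.
rewrite h -subr_ge0; apply: le_trans key _; rewrite mulr_sumr.
under eq_bigr do rewrite mulrBr.
rewrite sumrB -mulr_suml c0 mul0r subr0 -sumrB.
by apply: ler_sum => i _; rewrite mulrBl mulrA.
Qed.

Lemma free_image_unitmx d n (x : 'I_n -> 'cV[R]_d) (I : {set 'I_n}) :
  #|I| = d -> free [seq x i | i in I] ->
  exists2 e : 'I_d -> 'I_n,
    (\matrix_(a, k) x (e k) a ord0) \in unitmx &
    forall F : 'I_n -> R, \sum_(i in I) F i = \sum_k F (e k).
Proof.
(* Replacing [d] by [#|I|] lets [enum_val] number the columns without a cast. *)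
move=> cI; move: x; rewrite -cI => x fx.
exists (fun k => enum_val k); last by move=> F; rewrite big_enum_val.
set X := \matrix_(_, _) _.
rewrite -unitmx_tr -row_free_unit; apply/row_freeP.
have inj : forall v : 'rV_#|I|, v *m X^T = 0 -> v = 0.
  move=> v vX; apply/rowP => k; rewrite mxE.
  move: (fx) => /(@freeP _ _ _ [tuple of [seq x i | i in I]])/(_ (fun k => v ord0 k)).
  apply; apply/colP => a; rewrite summxE [RHS]mxE.
  transitivity ((v *m X^T) ord0 a); last by rewrite vX mxE.
  rewrite mxE.
  apply: eq_bigr => j _; rewrite !mxE; congr (_ * _).
  by rewrite /= (nth_image _) .
by apply/row_freeP; apply/inj_row_free.
Qed.

End PositiveDefinite.

(** * Limits of matrices *)

Section MatrixLimits.
Context {R : realType}.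

Lemma cvg_mx_entries (T : Type) m n (F : set_system T) (f : T -> 'M[R]_(m, n))
    (M : 'M[R]_(m, n)) : Filter F ->
  (forall i j, f t i j @[t --> F] --> M i j) -> f t @[t --> F] --> M.
Proof.
move=> FF fM A [P MP sPA]; apply: filterS sPA _.
have h : \forall t \near F, forall ij : 'I_m * 'I_n, P ij.1 ij.2 (f t ij.1 ij.2).
  by apply: filter_forall => -[i j]; exact: fM (MP i j).
by apply: filterS h => t ht i j; exact: ht (i, j).
Qed.

Lemma cvg_mx_coord (T : Type) m n (F : set_system T) (f : T -> 'M[R]_(m, n))
    (M : 'M[R]_(m, n)) i j : Filter F ->
  f t @[t --> F] --> M -> f t i j @[t --> F] --> M i j.
Proof. by move=> FF fM; exact: (cvg_comp _ _ fM (@coord_continuous _ m n i j M)). Qed.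

Lemma cvg_sumr (T : Type) (F : set_system T) (I : Type) (r : seq I)
    (f : I -> T -> R) (l : I -> R) : Filter F ->
  (forall i, f i t @[t --> F] --> l i) ->
  \sum_(i <- r) f i t @[t --> F] --> \sum_(i <- r) l i.
Proof.
move=> FF fl; elim: r => [|i r IH].
  by under eq_fun do rewrite big_nil; rewrite big_nil; exact: cvg_cst.
by under eq_fun do rewrite big_cons; rewrite big_cons; exact: cvgD.
Qed.

Lemma cvg_mulmx (T : Type) (F : set_system T) m n p
    (f : T -> 'M[R]_(m, n)) (g : T -> 'M[R]_(n, p))
    (A : 'M[R]_(m, n)) (B : 'M[R]_(n, p)) : Filter F ->
  f t @[t --> F] --> A -> g t @[t --> F] --> B ->
  f t *m g t @[t --> F] --> A *m B.
Proof.
move=> FF fA gB; apply: cvg_mx_entries => i j; rewrite mxE.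
under eq_fun do rewrite mxE.
by apply: cvg_sumr => k; apply: cvgM; exact: cvg_mx_coord.
Qed.

Lemma cvg_trmx (T : Type) (F : set_system T) m n
    (f : T -> 'M[R]_(m, n)) (A : 'M[R]_(m, n)) : Filter F ->
  f t @[t --> F] --> A -> (f t)^T @[t --> F] --> A^T.
Proof.
move=> FF fA; apply: cvg_mx_entries => i j; rewrite mxE.
by under eq_fun do rewrite mxE; exact: cvg_mx_coord.
Qed.

Section Differentiability.
Context {V : normedModType R}.
Implicit Types (v : V).

Lemma differentiable_sum_seq (I : Type) (r : seq I) (f : I -> V -> R) v :
  (forall i, differentiable (f i) v) ->
  differentiable (fun u => \sum_(i <- r) f i u) v.
Proof.
move=> df; elim: r => [|i r IH].
  by under eq_fun do rewrite big_nil; exact: differentiable_cst.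
by under eq_fun do rewrite big_cons; exact: differentiableD.
Qed.

Lemma differentiable_prod_seq (I : Type) (r : seq I) (f : I -> V -> R) v :
  (forall i, differentiable (f i) v) ->
  differentiable (fun u => \prod_(i <- r) f i u) v.
Proof.
move=> df; elim: r => [|i r IH].
  by under eq_fun do rewrite big_nil; exact: differentiable_cst.
by under eq_fun do rewrite big_cons; exact: differentiableM.
Qed.

Lemma differentiable_det d (F : V -> 'M[R]_d) v :
  (forall i j, differentiable (fun u => F u i j) v) ->
  differentiable (fun u => \det (F u)) v.
Proof.
move=> dF; apply: differentiable_sum_seq => s.
apply: differentiableM; first exact: differentiable_cst.
exact: differentiable_prod_seq.
Qed.

Lemma differentiable_adj d (F : V -> 'M[R]_d) v i j :
  (forall i j, differentiable (fun u => F u i j) v) ->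
  differentiable (fun u => \adj (F u) i j) v.
Proof.
move=> dF; under eq_fun do rewrite mxE /cofactor.
apply: differentiableM; first exact: differentiable_cst.
by apply: differentiable_det => k l; under eq_fun do rewrite !mxE.
Qed.

Lemma differentiable_ln (f : V -> R) v :
  differentiable f v -> 0 < f v -> differentiable (fun u => ln (f u)) v.
Proof.
move=> df f0; apply: (@differentiable_comp _ _ _ _ f (@ln R)) => //.
by apply/derivable1_diffP; have [] := is_derive1_ln f0.
Qed.

End Differentiability.

(** * Compactness along ultrafilters *)

Lemma ultra_bounded_cvg (T : Type) (U : set_system T) (f : T -> R) (B : R) :
  UltraFilter U -> (\forall t \near U, `|f t| <= B) ->
  exists l : R, f t @[t --> U] --> l.
Proof.
move=> UU fB.
have FU : UltraFilter (f @ U).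
  split => [|G PG UG]; first exact: fmap_proper_filter.
  apply/seteqP; split => // A GA.
  have [//|UA] := in_ultra_setVsetC (f @^-1` A) UU.
  by have [x []] := filter_ex (filterI GA (UG (~` A) UA)).
have := @segment_compact R (- B) B; rewrite compact_ultra => /(_ _ FU).
case; last by move=> l [_ fl]; exists l.
by apply: filterS fB => t; rewrite ler_norml /= in_itv.
Qed.

Lemma ultra_bounded_mx_cvg (T : Type) (U : set_system T) m n
    (f : T -> 'M[R]_(m, n)) (B : R) : UltraFilter U ->
  (\forall t \near U, forall i j, `|f t i j| <= B) ->
  exists M : 'M[R]_(m, n), f t @[t --> U] --> M.
Proof.
move=> UU fB.
have h i j : exists l : R, f t i j @[t --> U] --> l.
  by apply: (ultra_bounded_cvg UU (B := B)); apply: filterS fB.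
exists (\matrix_(i, j) projT1 (cid (h i j))); apply: cvg_mx_entries => i j.
by rewrite mxE; case: (cid (h i j)).
Qed.

(** The analogue of extracting a subsequence that avoids [B]: the trace of [F] on the complement of
    [B] is proper exactly because [B] is not in [F], and it extends to an ultrafilter. *)
Lemma not_filter_ultra (T : Type) (F : set_system T) (B : set T) :
  ProperFilter F -> ~ F B ->
  exists U : set_system T, [/\ UltraFilter U, F `<=` U & U (~` B)].
Proof.
move=> PF nFB; have PW : ProperFilter (within (~` B) F).
  apply: Build_ProperFilter_ex => C FC; apply: contrapT => C0; apply: nFB.
  apply: (@filterS _ F _ [set t | (~` B) t -> C t]) => [t Ct|//].
  by apply: contrapT => nB; apply: C0; exists t; exact: Ct.
have [U [UU WU]] := ultraFilterLemma PW.
exists U; split => //.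
  by move=> C FC; apply: WU; apply: filterS FC => t Ct _.
by apply: WU; apply: (@filterS _ F _ setT) => //; exact: filterT.
Qed.

(** The counterpart of the criterion that a sequence converges once each subsequence has a further
    subsequence with the same limit. *)
Lemma cvg_ultra_sub (T : Type) (S : topologicalType) (F : set_system T)
    (f : T -> S) (l : S) : ProperFilter F ->
  (forall U : set_system T, UltraFilter U -> F `<=` U -> f t @[t --> U] --> l) ->
  f t @[t --> F] --> l.
Proof.
move=> PF h A lA; apply: contrapT => nFA.
have [U [UU FU UnA]] := not_filter_ultra PF nFA.
have UA : U (f @^-1` A) := h U UU FU A lA.
by have [t []] := filter_ex (filterI UA UnA).
Qed.

Lemma cvg_det (T : Type) (F : set_system T) d (f : T -> 'M[R]_d) (A : 'M[R]_d) :
  Filter F -> f t @[t --> F] --> A -> \det (f t) @[t --> F] --> \det A.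
Proof.
move=> FF fA; apply: (cvg_comp f (fun B : 'M[R]_d => \det B) fA).
apply: differentiable_continuous; apply: differentiable_det => i j.
exact: differentiable_coord.
Qed.

Lemma cvg_adj (T : Type) (F : set_system T) d (f : T -> 'M[R]_d) (A : 'M[R]_d) :
  Filter F -> f t @[t --> F] --> A -> \adj (f t) @[t --> F] --> \adj A.
Proof.
move=> FF fA; apply: cvg_mx_entries => i j.
apply: (cvg_comp f (fun B : 'M[R]_d => \adj B i j) fA).
apply: (@differentiable_continuous _ _ _ A (fun B : 'M[R]_d => \adj B i j)).
apply: differentiable_adj => k l.
exact: differentiable_coord.
Qed.

Lemma cvg_invmx (T : Type) (F : set_system T) d (f : T -> 'M[R]_d) (A : 'M[R]_d) :
  Filter F -> A \in unitmx -> (\forall t \near F, f t \in unitmx) ->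
  f t @[t --> F] --> A -> invmx (f t) @[t --> F] --> invmx A.
Proof.
move=> FF Au fu fA.
(* [invmx] is defined by cases, but near [F] it agrees with Cramer's formula, which is continuous
   where the determinant is nonzero. *)
suff h : (\det (f t))^-1 *: \adj (f t) @[t --> F] --> invmx A.
  apply: cvg_trans h; apply: near_eq_cvg.
  by apply: filterS fu => t tu; rewrite /invmx tu.
rewrite /invmx Au; apply: cvgZ; last exact: cvg_adj.
by apply: cvgV; [rewrite -unitfE -unitmxE | exact: cvg_det].
Qed.

End MatrixLimits.

(** * Coercivity *)

Section Likelihood.
Context {R : realType} {d n : nat} (x : 'I_n -> 'cV[R]_d) (w : 'I_n -> R).
Hypotheses (hd : (0 < d)%N) (w_gt0 : forall i, 0 < w i)
  (w_sum1 : \sum_(i < n) w i = 1)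
  (x_free : forall I : {set 'I_n}, (#|I| <= d)%N -> free [seq x i | i in I])
  (w_max : forall i, d%:R * w i <= 1).
Local Notation delta S i := (mahalanobis S (x i)).
Implicit Types (S P : 'M[R]_d).

Lemma delta_gt0 S i : SPD S -> 0 < delta S i.
Proof.
move=> /SPD_invmx[_]; apply.
have := @x_free [set i]%SET; rewrite cards1 => /(_ hd).
by rewrite /image_mem enum_set1 /= seq1_free.
Qed.

Lemma gram_diag P (e : 'I_d -> 'I_n) k :
  let X := \matrix_(a, k) x (e k) a ord0 in
  (X^T *m P *m X) k k = ((x (e k))^T *m P *m x (e k)) ord0 ord0.
Proof.
move=> X; rewrite !mxE; apply: eq_bigr => j _; rewrite !mxE; congr (_ * _).
by apply: eq_bigr => l _; rewrite !mxE.
Qed.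

(** The cardinality condition sits inside the existential so that [choice] yields a constant for
    every subset; finitely many subsets then give a uniform one. *)
Lemma ln_prod_delta_ge (I : {set 'I_n}) : exists C, #|I| = d ->
  forall S, SPD S -> - C <= \sum_(i in I) ln (delta S i) + ln (\det S).
Proof.
have [cI|nI] := eqVneq #|I| d; last by exists 0 => /eqP; rewrite (negbTE nI).
have [e Xu sumI] := free_image_unitmx cI (x_free (eq_leq cI)).
set X := \matrix_(_, _) _ in Xu.
have X0 : 0 < \det X ^+ 2 by rewrite exprn_even_gt0 //= -unitfE -unitmxE.
exists (- ln (\det X ^+ 2)) => _ S SS.
have SM := SPD_congr Xu (SPD_invmx SS).
have := hadamard SM.
rewrite -ler_ln ?posrE ?SPD_det_gt0 //; last first.
  by apply: prodr_gt0 => i _; rewrite gram_diag delta_gt0.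
rewrite ln_prod; last by move=> k; rewrite gram_diag delta_gt0.
under eq_bigr do rewrite gram_diag.
rewrite sumI !det_mulmx det_tr mulrAC -expr2 lnM ?posrE //; last first.
  by rewrite SPD_det_gt0 //; exact: SPD_invmx.
by rewrite det_inv lnV ?posrE ?SPD_det_gt0 //; lra.
Qed.

(** Each of the [d] selected terms satisfies [ln (1 + delta / c) >= ln delta - ln c]. The bound is
    uniform in [c] and keeps [d ln c] explicit, so that it can later be used with [c = nu] as [nu]
    tends to 0. *)
Lemma tyler_bound : exists C, forall S c, SPD S -> 0 < c ->
  - C - d%:R * ln c <= d%:R * (\sum_i w i * ln (1 + delta S i / c)) + ln (\det S).
Proof.
have /choice[C hC] := ln_prod_delta_ge.
exists (\sum_I `|C I|) => S c SS c0.
pose y i := ln (1 + delta S i / c).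
have [I cI hI] := weighted_sum_ge_subset y hd (fun i => ltW (w_gt0 i)) w_max w_sum1.
have h1 := hC I cI S SS.
have h2 : C I <= \sum_I `|C I|.
  apply: le_trans (ler_norm _) _; rewrite (bigD1 I) //= lerDl.
  by apply: sumr_ge0 => J _.
have h3 : \sum_(i in I) ln (delta S i) - d%:R * ln c <= \sum_(i in I) y i.
  have -> : d%:R * ln c = \sum_(i in I) ln c by rewrite sumr_const cI mulr_natl.
  rewrite -sumrB; apply: ler_sum => i _; have d0 := delta_gt0 i SS.
  rewrite -ln_div ?posrE // ler_ln ?posrE ?divr_gt0 //; first lra.
  by rewrite addr_gt0 ?divr_gt0.
rewrite -/(\sum_i w i * y i); lra.
Qed.

Lemma sum_ln_delta_ge0 S b : 0 < b -> SPD S ->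
  0 <= \sum_i w i * ln (1 + delta S i / b).
Proof.
move=> b0 SS; apply: sumr_ge0 => i _; rewrite mulr_ge0 ?(ltW (w_gt0 i)) //.
by rewrite ln_ge0 // lerDl divr_ge0 ?(ltW b0) ?(ltW (delta_gt0 i SS)).
Qed.

(** Once [tyler_bound] has consumed the share [d] of the coefficient, the share [a] bounds the sum
    of nonnegative terms, hence each of them. [D i] is the resulting inequality solved for
    [delta S i]. *)
Lemma delta_bounded a b K : 0 < a -> 0 < b -> exists D, forall S, SPD S ->
  (d%:R + a) * (\sum_i w i * ln (1 + delta S i / b)) + ln (\det S) <= K ->
  forall i, delta S i <= D.
Proof.
move=> a0 b0; have [C hC] := tyler_bound.
pose D i := b * expR ((K + C + d%:R * ln b) / (a * w i)).
exists (\sum_i D i) => S SS hK i.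
have := hC S b SS b0; set s := \sum_i _ in hK * => h.
have le_s : w i * ln (1 + delta S i / b) <= s.
  rewrite /s (bigD1 i) //= lerDl; apply: sumr_ge0 => j _.
  rewrite mulr_ge0 ?(ltW (w_gt0 j)) // ln_ge0 // lerDl.
  by rewrite divr_ge0 ?(ltW b0) ?(ltW (delta_gt0 j SS)).
have h2 : a * (w i * ln (1 + delta S i / b)) <= K + C + d%:R * ln b.
  by apply: (@le_trans _ _ (a * s)); [rewrite ler_pM2l | lra].
have DI : D i <= \sum_i D i.
  rewrite (bigD1 i) //= lerDl; apply: sumr_ge0 => j _.
  by rewrite mulr_ge0 ?expR_ge0 ?ltW.
apply: le_trans DI; rewrite /D mulrC -ler_pdivrMr //.
have p0 : 0 < 1 + delta S i / b by rewrite addr_gt0 ?divr_gt0 ?delta_gt0.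
apply: (@le_trans _ _ (1 + delta S i / b)); first by rewrite lerDr.
rewrite -[leLHS](lnK (x := 1 + delta S i / b)) ?posrE // ler_expR.
by rewrite ler_pdivlMr ?mulr_gt0 // mulrC -mulrA.
Qed.

Lemma exists_free_samples :
  exists e : 'I_d -> 'I_n, (\matrix_(a, k) x (e k) a ord0) \in unitmx.
Proof.
have [I cI _] := weighted_sum_ge_subset w hd (fun i => ltW (w_gt0 i)) w_max w_sum1.
by have [e Xu _] := free_image_unitmx cI (x_free (eq_leq cI)); exists e.
Qed.

(** Compactness is applied to a factor [L] of [X^T S^-1 X], not to [S]. The [delta] bounds control
    its diagonal, hence all entries of [L]; since the weighted sum is nonnegative,
    [ln (\det S) <= K], which keeps the limit of [L] invertible. [S] is then recovered as a
    continuous function of [L], and its limit is positive definite by its form. *)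
Lemma SPD_ultra_cvg (T : Type) (U : set_system T) (S : T -> 'M[R]_d) a b K :
  UltraFilter U -> 0 < a -> 0 < b -> (forall t, SPD (S t)) ->
  (\forall t \near U,
    (d%:R + a) * (\sum_i w i * ln (1 + delta (S t) i / b)) + ln (\det (S t)) <= K) ->
  exists2 S0 : 'M[R]_d, SPD S0 & S t @[t --> U] --> S0.
Proof.
move=> UU a0 b0 SS hK.
have [D hD] := delta_bounded K a0 b0.
have [e Xu] := exists_free_samples.
set X := \matrix_(_, _) _ in Xu.
have X0 : 0 < \det X ^+ 2 by rewrite exprn_even_gt0 //= -unitfE -unitmxE.
have /choice[L hL] : forall t, exists L : 'M[R]_d, L \in unitmx /\
    X^T *m invmx (S t) *m X = L *m L^T.
  move=> t; have [L Lu LE] := SPD_factor (SPD_congr Xu (SPD_invmx (SS t))).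
  by exists L.
have [L0 cL] : exists L0 : 'M[R]_d, L t @[t --> U] --> L0.
  (* [D + 1] bounds any number whose square is at most [D]. *)
  apply: (ultra_bounded_mx_cvg UU (B := D + 1)).
  apply: filterS hK => t ht i j; have [_ LE] := hL t.
  have := mulmx_tr_entry_le (L t) i j; rewrite -LE gram_diag => h.
  have {}h := le_trans h (hD (S t) (SS t) ht (e i)).
  have : (`|L t i j|) ^+ 2 <= D by rewrite real_normK // num_real.
  by have := normr_ge0 (L t i j); nra.
have L0u : L0 \in unitmx.
  have c2 : \det (L t) ^+ 2 @[t --> U] --> \det L0 ^+ 2.
    by rewrite expr2; under eq_fun do rewrite expr2; apply: cvgM; exact: cvg_det.
  have : expR (- K) * \det X ^+ 2 <= \det L0 ^+ 2.
    rewrite -(cvg_lim _ c2) //; apply: limr_ge; first by apply/cvg_ex; eexists; exact: c2.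
    apply: filterS hK => t ht; have [_ LE] := hL t.
    have -> : \det (L t) ^+ 2 = (\det (S t))^-1 * \det X ^+ 2.
      have := congr1 (fun M : 'M[R]_d => \det M) LE.
      rewrite !det_mulmx !det_tr det_inv -!expr2 => <-; ring.
    rewrite ler_pM2r // -[leRHS](lnK (x := (\det (S t))^-1)) ?posrE ?invr_gt0 ?SPD_det_gt0 //.
    rewrite ler_expR lnV ?posrE ?SPD_det_gt0 // lerN2; apply: le_trans ht.
    by rewrite lerDr mulr_ge0 ?addr_ge0 ?(ltW a0) // sum_ln_delta_ge0.
  rewrite unitmxE unitfE; apply: contraTneq => ->.
  by rewrite expr0n /= -ltNge mulr_gt0 ?expR_gt0.
pose Y M := X *m (invmx M)^T : 'M[R]_d.
have SE t : S t = Y (L t) *m (Y (L t))^T.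
  have [Lu LE] := hL t; have Su := SPD_unitmx (SS t).
  rewrite /Y trmx_mul trmxK mulmxA -[X *m _ *m _]mulmxA -invmx_mulmx_tr // -LE.
  rewrite !invmx_mul ?unitmx_mul ?unitmx_inv ?unitmx_tr ?Su ?Xu // invmxK.
  by rewrite !mulmxA mulmxV // mul1mx -mulmxA mulVmx ?unitmx_tr // mulmx1.
exists (Y L0 *m (Y L0)^T).
  by apply: SPD_mulmx_tr; rewrite unitmx_mul Xu unitmx_tr unitmx_inv.
under eq_fun do rewrite SE.
have cY : Y (L t) @[t --> U] --> Y L0.
  apply: cvg_mulmx; first exact: cvg_cst.
  apply: cvg_trmx; apply: cvg_invmx => //.
  by apply: nearW => t; have [] := hL t.
by apply: cvg_mulmx => //; exact: cvg_trmx.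
Qed.

End Likelihood.

(** * The degrees of freedom *)

Section DegreesOfFreedom.
Context {R : realType}.
Implicit Types (s a nu : R).

Lemma derivable_lnGamma s : 0 < s -> derivable (fun u => ln (Gamma u)) s 1.
Proof.
move=> s0; apply/derivable1_diffP; apply: differentiable_ln; last exact: Gamma_gt0.
by apply/derivable1_diffP; exact: derivable_Gamma.
Qed.

Lemma cvg_lnGamma (T : Type) (F : set_system T) (f : T -> R) s : Filter F ->
  0 < s -> f t @[t --> F] --> s -> ln (Gamma (f t)) @[t --> F] --> ln (Gamma s).
Proof.
move=> FF s0 fs; apply: (cvg_comp f (fun u => ln (Gamma u)) fs).
apply: (@differentiable_continuous _ _ _ s (fun u => ln (Gamma u))).
by apply/derivable1_diffP; exact: derivable_lnGamma.
Qed.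

Lemma cvg_ln (T : Type) (F : set_system T) (f : T -> R) s : Filter F ->
  0 < s -> f t @[t --> F] --> s -> ln (f t) @[t --> F] --> ln s.
Proof.
by move=> FF s0 fs; apply: (cvg_comp f (@ln R) fs); exact: continuous_ln.
Qed.

(** The part of [tL] that depends on [nu] alone once [ln nu] is pulled out of each logarithm:
    [- nu ln nu + (d + nu) ln nu] leaves [d ln nu]. *)
Definition dof_term (d : nat) nu : R :=
  - 2 * ln (Gamma ((d%:R + nu) / 2)) + 2 * ln (Gamma (nu / 2)) + d%:R * ln nu.

(** The upper bound is [Gamma_half_le] at [s]; the lower one is the same inequality at [s + 1/2],
    combined with the functional equation. *)
Lemma lnGamma_half_bounds s : 0 < s ->
  2 * ln s - ln (s + 2^-1) <= 2 * (ln (Gamma (s + 2^-1)) - ln (Gamma s)) <= ln s.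
Proof.
move: (@Gamma_gt0 R) (@GammaD1 R) (@Gamma_half_le R).
(* With [Gamma] left in the goal, [ring] and [lra] would unfold the integral. *)
move: (@Gamma R) => g g0 gD1 gh s0; have sh0 : 0 < s + 2^-1 by lra.
have G0 := g0 _ s0; have Gh0 := g0 _ sh0.
have := gh _ s0; have := gh _ sh0.
have -> : s + 2^-1 + 2^-1 = s + 1 by lra.
rewrite gD1 //.
rewrite -ler_ln ?posrE ?mulr_gt0 ?exprn_gt0 ?mulr_gt0 //.
rewrite !lnXn ?mulr_gt0 // !lnM ?posrE ?exprn_gt0 // ?lnXn // => h1.
rewrite -ler_ln ?posrE ?mulr_gt0 ?exprn_gt0 ?mulr_gt0 //.
rewrite !lnM ?posrE ?exprn_gt0 // => h2.
by apply/andP; split; lra.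
Qed.

(** The log-ratio of Gamma at [(d + nu) / 2] and [nu / 2] telescopes over [d] steps of 1/2, each
    matched with one of the [d] copies of [ln nu]. *)
Lemma dof_termE d nu : 0 < nu -> dof_term d nu =
  \sum_(j < d) (ln nu - 2 * (ln (Gamma ((nu + j%:R) / 2 + 2^-1))
                             - ln (Gamma ((nu + j%:R) / 2)))).
Proof.
rewrite /dof_term; move: (@Gamma R) => g nu0; elim: d => [|d IH].
  by rewrite big_ord0 add0r mul0r addr0 mulNr addNr.
rewrite big_ord_recr /= -IH.
have -> : (d.+1%:R + nu) / 2 = (nu + d%:R) / 2 + 2^-1 by rewrite -natr1; lra.
have -> : (d%:R + nu) / 2 = (nu + d%:R) / 2 by lra.
by rewrite -natr1; ring.
Qed.

Lemma cvgy_inv (T : Type) (F : set_system T) (f : T -> R) : Filter F ->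
  f t @[t --> F] --> +oo -> (f t)^-1 @[t --> F] --> 0.
Proof. by move=> FF fy; apply/gtr0_cvgV0 => //; exact: cvgry_gt. Qed.

Lemma cvg_ln_1D_div (T : Type) (F : set_system T) (f : T -> R) a : Filter F ->
  f t @[t --> F] --> +oo -> ln (1 + a / f t) @[t --> F] --> 0.
Proof.
move=> FF fy; rewrite -[X in _ --> X]ln1; apply: cvg_ln => //.
rewrite -[X in _ --> X]addr0; apply: cvgD; first exact: cvg_cst.
rewrite -[X in _ --> X](mulr0 a); apply: cvgM; first exact: cvg_cst.
exact: cvgy_inv.
Qed.

Lemma dof_term_cvgy (T : Type) (F : set_system T) (f : T -> R) d : Filter F ->
  f t @[t --> F] --> +oo -> dof_term d (f t) @[t --> F] --> d%:R * ln 2.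
Proof.
move=> FF fy.
have f0 : \forall t \near F, 0 < f t by exact: cvgry_gt.
have -> : d%:R * ln 2 = \sum_(j < d) ln 2 :> R by rewrite sumr_const card_ord mulr_natl.
suff h : \sum_(j < d) (ln (f t) - 2 * (ln (Gamma ((f t + j%:R) / 2 + 2^-1))
    - ln (Gamma ((f t + j%:R) / 2)))) @[t --> F] --> \sum_(j < d) ln 2.
  apply: cvg_trans h; apply: near_eq_cvg; apply: filterS f0 => t ft.
  by rewrite dof_termE.
apply: cvg_sumr => j.
(* With [s = (nu + j) / 2], twice a half-step of [ln Gamma] is asymptotically [ln s], that is
   [ln nu - ln 2]; every summand therefore tends to [ln 2]. *)
apply: (@squeeze_cvgr _ _ _ _ (fun t => ln 2 - ln (1 + j%:R / f t))
  (fun t => ln 2 - 2 * ln (1 + j%:R / f t) + ln (1 + (j%:R + 1) / f t))).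
- apply: filterS f0 => t ft.
  have j0 : 0 <= j%:R :> R by [].
  have s0 : 0 < (f t + j%:R) / 2 by lra.
  have /andP[] := lnGamma_half_bounds s0.
  move: (@Gamma R) => g b1 b2.
  have e1 : ln ((f t + j%:R) / 2) = ln (f t) + ln (1 + j%:R / f t) - ln 2.
    have p : 0 < 1 + j%:R / f t by rewrite ltr_pwDl // divr_ge0 // ltW.
    rewrite -lnM ?posrE // -ln_div ?posrE ?mulr_gt0 //.
    by congr ln; field; rewrite gt_eqF.
  have e2 : ln ((f t + j%:R) / 2 + 2^-1) = ln (f t) + ln (1 + (j%:R + 1) / f t) - ln 2.
    have p : 0 < 1 + (j%:R + 1) / f t by rewrite ltr_pwDl // divr_ge0 ?addr_ge0 // ltW.
    rewrite -lnM ?posrE // -ln_div ?posrE ?mulr_gt0 //.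
    by congr ln; field; rewrite gt_eqF.
  by rewrite e1 e2 in b1 b2; apply/andP; split; lra.
- rewrite -[X in _ --> X]subr0; apply: cvgB; first exact: cvg_cst.
  exact: cvg_ln_1D_div.
- rewrite [X in _ --> X](_ : ln 2 = ln 2 - 2 * 0 + 0); last by rewrite mulr0 subr0 addr0.
  apply: cvgD; last exact: cvg_ln_1D_div.
  apply: cvgB; first exact: cvg_cst.
  by apply: cvgM; [exact: cvg_cst | exact: cvg_ln_1D_div].
Qed.

Lemma dof_term_cvg (T : Type) (F : set_system T) (f : T -> R) d a : Filter F ->
  0 < a -> f t @[t --> F] --> a -> dof_term d (f t) @[t --> F] --> dof_term d a.
Proof.
move=> FF a0 fa; have d0 : 0 <= d%:R :> R by [].
apply: cvgD; last by apply: cvgM; [exact: cvg_cst | exact: cvg_ln].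
apply: cvgD; (apply: cvgM; first exact: cvg_cst).
  apply: cvg_lnGamma; first lra.
  by apply: cvgM; [apply: cvgD => //|]; exact: cvg_cst.
apply: cvg_lnGamma; first lra.
by apply: cvgM => //; exact: cvg_cst.
Qed.

(* [Gamma (nu / 2) = Gamma (nu / 2 + 1) / (nu / 2)] blows up as [nu -> 0]. *)
Lemma dof_term_bounded_gt0 (T : Type) (F : set_system T) (f : T -> R) d a (K : R) :
  ProperFilter F -> (0 < d)%N -> (forall t, 0 < f t) -> f t @[t --> F] --> a ->
  (\forall t \near F, dof_term d (f t) - d%:R * ln (f t) <= K) -> 0 < a.
Proof.
move=> FF d0 f0 fa hK.
have dR : 0 < d%:R :> R by rewrite ltr0n.
have a0 : 0 <= a.
  rewrite -(cvg_lim _ fa) //; apply: limr_ge; first by apply/cvg_ex; exists a.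
  by apply: nearW => t; exact: ltW.
rewrite lt_neqAle a0 andbT eq_sym; apply/eqP => aE; rewrite aE in fa => {a0}.
pose g t := - 2 * ln (Gamma ((d%:R + f t) / 2)) + 2 * ln (Gamma (f t / 2 + 1)).
have cg : g t @[t --> F] --> - 2 * ln (Gamma ((d%:R + 0) / 2)) + 2 * ln (Gamma (0 / 2 + 1)).
  apply: cvgD; (apply: cvgM; first exact: cvg_cst).
    apply: cvg_lnGamma; first lra.
    by apply: cvgM; [apply: cvgD => //|]; exact: cvg_cst.
  apply: cvg_lnGamma; first lra.
  by apply: cvgD; [apply: cvgM => // |]; exact: cvg_cst.
set l := (X in _ --> X) in cg.
have gl : \forall t \near F, l - 1 < g t by apply: cvgr_gt cg _ _; lra.
(* Chosen so that [f t < e] gives [- 2 ln (f t / 2) > K - l + 1]; added to [g t > l - 1], this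
   exceeds [K]. *)
pose e := 2 * expR (- (K - l + 1) / 2).
have e0 : 0 < e by rewrite mulr_gt0 ?expR_gt0.
have fe : \forall t \near F, f t < e by exact: cvgr_lt fa _ e0.
have [t [[h1 h2] h3]] := filter_ex (filterI (filterI hK gl) fe).
have ft := f0 t; have ft2 : 0 < f t / 2 by lra.
move: h1; rewrite /dof_term addrK.
have -> : ln (Gamma (f t / 2)) = ln (Gamma (f t / 2 + 1)) - ln (f t / 2).
  by rewrite GammaD1 // lnM ?posrE ?Gamma_gt0 // [ln _ + _]addrC addrK.
have h4 : ln (f t / 2) < - (K - l + 1) / 2.
  rewrite -(expRK (- (K - l + 1) / 2)) ltr_ln ?posrE ?expR_gt0 //.
  by rewrite ltr_pdivrMr // mulrC.
clear cg gl hK; clearbody l; move: h2 h4; rewrite /g; move: (@Gamma R) => G.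
by lra.
Qed.

(** Convexity of the exponential between 0 and [y]: the tangent line at [th * y] is evaluated at
    both ends and averaged with weights [1 - th] and [th]. *)
Lemma expR_mul_le (th y : R) : 0 <= th <= 1 ->
  expR (th * y) <= 1 + th * (expR y - 1).
Proof.
move=> /andP[th0 th1]; have E0 := expR_gt0 (th * y).
have h1 := expR_ge1Dx (y - th * y); have h2 := expR_ge1Dx (- (th * y)).
have e1 : expR y = expR (th * y) * expR (y - th * y).
  by rewrite -expRD addrC subrK.
have e2 : 1 = expR (th * y) * expR (- (th * y)) by rewrite -expRD subrr expR0.
have k1 := ler_wpM2l (ltW E0) h1; have k2 := ler_wpM2l (ltW E0) h2.
rewrite -e1 in k1; rewrite -e2 in k2.
have t1 := ler_wpM2l th0 k1.
have th1' : 0 <= 1 - th by lra.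
have t2 := ler_wpM2l th1' k2; lra.
Qed.

(** Bernoulli's inequality with exponent [b / nu]. As [nu] grows it gives a lower bound with a fixed
    [b]. *)
Lemma mul_ln_1D_div_nondecreasing (b nu delta : R) :
  0 < b -> b <= nu -> 0 <= delta ->
  b * ln (1 + delta / b) <= nu * ln (1 + delta / nu).
Proof.
move=> b0 bnu d0; have nu0 : 0 < nu by apply: lt_le_trans bnu.
have p1 : 0 < 1 + delta / b by rewrite ltr_pwDl // divr_ge0 // ltW.
have p2 : 0 < 1 + delta / nu by rewrite ltr_pwDl // divr_ge0 // ltW.
have t01 : 0 <= b / nu <= 1.
  by rewrite divr_ge0 ?(ltW b0) ?(ltW nu0) //= ler_pdivrMr // mul1r.
have := expR_mul_le (ln (1 + delta / b)) t01; rewrite lnK ?posrE //.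
have -> : 1 + b / nu * (1 + delta / b - 1) = 1 + delta / nu.
  by field; rewrite !gt_eqF.
rewrite -ler_ln ?posrE ?expR_gt0 // expRK => h.
have -> : b * ln (1 + delta / b) = nu * (b / nu * ln (1 + delta / b)).
  by rewrite [b / nu]mulrC !mulrA mulfV ?mul1r // gt_eqF.
by rewrite ler_pM2l.
Qed.

Lemma cvg_dof_ln (T : Type) (F : set_system T) (f g : T -> R) (c l : R) :
  Filter F -> f t @[t --> F] --> +oo -> g t @[t --> F] --> l ->
  (forall t, 0 <= g t) ->
  (c + f t) * ln (1 + g t / f t) @[t --> F] --> l.
Proof.
move=> FF fy gl g0.
have f0 : \forall t \near F, 0 < f t by exact: cvgry_gt.
have gf : g t / f t @[t --> F] --> 0.
  by rewrite -[X in _ --> X](mulr0 l); apply: cvgM => //; exact: cvgy_inv.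
have lngf : ln (1 + g t / f t) @[t --> F] --> 0.
  rewrite -[X in _ --> X]ln1; apply: cvg_ln => //.
  by rewrite -[X in _ --> X]addr0; apply: cvgD => //; exact: cvg_cst.
rewrite [X in _ --> X](_ : l = c * 0 + l); last by rewrite mulr0 add0r.
under eq_fun do rewrite mulrDl.
apply: cvgD; first by apply: cvgM => //; exact: cvg_cst.
(* The bounds [u / (1 + u) <= ln (1 + u) <= u] at [u = g / f], multiplied by [f]. *)
apply: (@squeeze_cvgr _ _ _ _ (fun t => g t * (1 + g t / f t)^-1) g); last exact: gl.
  apply: filterS f0 => t ft; have gt := g0 t.
  have p : 0 < 1 + g t / f t by rewrite ltr_pwDl // divr_ge0 // ltW.
  have q : 0 <= g t / f t by rewrite divr_ge0 // ltW.
  apply/andP; split.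
    have i0 : 0 < (1 + g t / f t)^-1 by rewrite invr_gt0.
    have h : ln (1 + ((1 + g t / f t)^-1 - 1)) <= (1 + g t / f t)^-1 - 1.
      by apply: le_ln1Dx; lra.
    rewrite addrC subrK lnV ?posrE // in h.
    rewrite [leRHS]mulrC -ler_pdivrMr // mulrAC.
    have -> : g t / f t / (1 + g t / f t) = 1 - (1 + g t / f t)^-1.
      by field; rewrite gt_eqF //; apply/andP; split => //; rewrite gt_eqF //; lra.
    lra.
  have := le_ln1Dx (_ : -1 < g t / f t) => h.
  rewrite mulrC -ler_pdivlMr //; apply: h; lra.
rewrite -[X in _ --> X]mulr1; apply: cvgM => //.
rewrite -[X in _ --> X]invr1; apply: cvgV; first exact: oner_neq0.
by rewrite -[X in _ --> X]addr0; apply: cvgD => //; exact: cvg_cst.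
Qed.

End DegreesOfFreedom.

(** * Limits of the likelihood *)

Section LikelihoodLimits.
Context {R : realType} {d n : nat} (x : 'I_n -> 'cV[R]_d) (w : 'I_n -> R).
Hypotheses (hd : (0 < d)%N) (w_gt0 : forall i, 0 < w i)
  (w_sum1 : \sum_(i < n) w i = 1)
  (x_free : forall I : {set 'I_n}, (#|I| <= d)%N -> free [seq x i | i in I])
  (w_max : forall i, d%:R * w i <= 1).
Local Notation delta S i := (mahalanobis S (x i)).
Local Notation L := (tL x w).
Implicit Types (S : 'M[R]_d) (nu : R).

Lemma tLE nu S : 0 < nu -> SPD S -> L nu S = dof_term d nu +
  (d%:R + nu) * (\sum_i w i * ln (1 + delta S i / nu)) + ln (\det S).
Proof.
move=> nu0 SS; rewrite /tL /dof_term; move: (@Gamma R) => g.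
have -> : \sum_i w i * ln (nu + delta S i) =
    ln nu + \sum_i w i * ln (1 + delta S i / nu).
  have e : ln nu = \sum_i w i * ln nu by rewrite -mulr_suml w_sum1 mul1r.
  rewrite [X in _ = X + _]e -big_split /=; apply: eq_bigr => i _.
  have d0 := delta_gt0 hd x_free i SS.
  have p : 0 < 1 + delta S i / nu by rewrite addr_gt0 ?divr_gt0.
  rewrite -mulrDr -lnM ?posrE //; congr (_ * ln _).
  by field; rewrite gt_eqF.
move: (\sum_i _) => s; ring.
Qed.

Lemma delta_cvg (T : Type) (F : set_system T) (S : T -> 'M[R]_d) S0 i : Filter F ->
  (forall t, SPD (S t)) -> SPD S0 -> S t @[t --> F] --> S0 ->
  delta (S t) i @[t --> F] --> delta S0 i.
Proof.
move=> FF SS SS0 cS; rewrite /mahalanobis.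
apply: (@cvg_mx_coord _ _ _ _ _ (fun t => (x i)^T *m invmx (S t) *m x i)).
apply: cvg_mulmx; last exact: cvg_cst.
apply: cvg_mulmx; first exact: cvg_cst.
by apply: cvg_invmx => //; [exact: SPD_unitmx | apply: nearW => t; exact: SPD_unitmx].
Qed.

Lemma ln_det_cvg (T : Type) (F : set_system T) (S : T -> 'M[R]_d) S0 : Filter F ->
  SPD S0 -> S t @[t --> F] --> S0 -> ln (\det (S t)) @[t --> F] --> ln (\det S0).
Proof. by move=> FF SS0 cS; apply: cvg_ln; [exact: SPD_det_gt0|exact: cvg_det]. Qed.

Lemma tL_cvg (T : Type) (F : set_system T) (nu : T -> R) (S : T -> 'M[R]_d) (a : R) S0 :
  Filter F -> (forall t, 0 < nu t) -> (forall t, SPD (S t)) -> 0 < a -> SPD S0 ->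
  nu t @[t --> F] --> a -> S t @[t --> F] --> S0 ->
  L (nu t) (S t) @[t --> F] --> L a S0.
Proof.
move=> FF nu0 SS a0 SS0 cnu cS; rewrite tLE //.
under eq_fun do rewrite tLE //.
apply: cvgD; last exact: ln_det_cvg.
apply: cvgD; first exact: dof_term_cvg.
apply: cvgM; first by apply: cvgD => //; exact: cvg_cst.
apply: cvg_sumr => i; apply: cvgM; first exact: cvg_cst.
apply: cvg_ln.
  by rewrite addr_gt0 ?divr_gt0 // (delta_gt0 hd x_free).
apply: cvgD; first exact: cvg_cst.
apply: cvgM; first exact: delta_cvg.
by apply: cvgV => //; rewrite gt_eqF.
Qed.

Definition gauss_nll S := \sum_i w i * delta S i + ln (\det S).

Lemma tL_cvgy (T : Type) (F : set_system T) (nu : T -> R) (S : T -> 'M[R]_d) S0 :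
  Filter F -> (forall t, 0 < nu t) -> (forall t, SPD (S t)) -> SPD S0 ->
  nu t @[t --> F] --> +oo -> S t @[t --> F] --> S0 ->
  L (nu t) (S t) @[t --> F] --> d%:R * ln 2 + gauss_nll S0.
Proof.
move=> FF nu0 SS SS0 cnu cS; rewrite /gauss_nll addrA.
under eq_fun do rewrite tLE //.
apply: cvgD; last exact: ln_det_cvg.
apply: cvgD; first exact: dof_term_cvgy.
under eq_fun do rewrite mulr_sumr.
apply: cvg_sumr => i; under eq_fun do rewrite mulrCA.
apply: cvgM; first exact: cvg_cst.
apply: cvg_dof_ln => //; first exact: delta_cvg.
by move=> t; rewrite ltW // (delta_gt0 hd x_free).
Qed.

Lemma w_sum_mahalanobis S :
  \sum_i w i * delta S i = \tr (invmx S *m \sum_i w i *: (x i *m (x i)^T)).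
Proof.
rewrite mulmx_sumr raddf_sum /=; apply: eq_bigr => i _.
rewrite -scalemxAr linearZ /= mulmxA mxtrace_mulC mulmxA /mahalanobis.
by rewrite /mxtrace big_ord_recl big_ord0 addr0.
Qed.

Lemma sigma_hat_SPD : SPD (\sum_i w i *: (x i *m (x i)^T)).
Proof.
split.
  rewrite linear_sum /=; apply: eq_bigr => i _.
  by rewrite linearZ /= trmx_mul trmxK.
move=> v v0.
have E i : (v^T *m (w i *: (x i *m (x i)^T)) *m v) ord0 ord0 =
    w i * ((v^T *m x i) ord0 ord0) ^+ 2.
  rewrite -scalemxAr -scalemxAl mxE; congr (_ * _).
  transitivity (((v^T *m x i) *m (v^T *m x i)^T) ord0 ord0).
    by rewrite trmx_mul trmxK !mulmxA.
  by rewrite mxE big_ord_recl big_ord0 addr0 [X in _ * X]mxE expr2.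
rewrite mulmx_sumr mulmx_suml summxE; under eq_bigr do rewrite E.
have h i : 0 <= w i * ((v^T *m x i) ord0 ord0) ^+ 2.
  by rewrite mulr_ge0 ?sqr_ge0 // ltW.
rewrite lt_neqAle sumr_ge0 // andbT eq_sym; apply: contra v0 => /eqP/psumr_eq0P h0.
have {}h0 i : (v^T *m x i) ord0 ord0 = 0.
  apply/eqP; have /eqP := h0 (fun i _ => h i) i isT.
  by rewrite mulf_eq0 gt_eqF //= sqrf_eq0.
(* By now [v] is orthogonal to every sample; [d] independent ones force [v = 0]. *)
have [e Xu] := exists_free_samples hd w_gt0 w_sum1 x_free w_max.
set X := \matrix_(_, _) _ in Xu.
have vX : v^T *m X = 0.
  apply/rowP => k; rewrite [RHS]mxE -(h0 (e k)) !mxE.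
  by apply: eq_bigr => j _; rewrite !mxE.
apply/eqP; rewrite -[v]trmxK -[v^T]mulmx1 -(mulmxV Xu) mulmxA vX mul0mx.
exact: trmx0.
Qed.

Lemma gauss_nll_min S : SPD S ->
  let S0 := \sum_i w i *: (x i *m (x i)^T) in
  gauss_nll S0 <= gauss_nll S /\ (gauss_nll S <= gauss_nll S0 -> S = S0).
Proof.
move=> SS S0; have SS0 := sigma_hat_SPD.
have [h1 h2] := gauss_divergence SS SS0.
have e : gauss_nll S0 = d%:R + ln (\det S0).
  by rewrite /gauss_nll w_sum_mahalanobis mulVmx ?SPD_unitmx // mxtrace1.
by rewrite e /gauss_nll w_sum_mahalanobis.
Qed.

Lemma normal_loglikE S : SPD S -> normal_loglik x w S =
  - (d%:R / 2) * ln (2 * pi) - gauss_nll S / 2.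
Proof.
move=> SS; have D0 := SPD_det_gt0 SS; have p0 : 0 < 2 * pi :> R.
  by rewrite mulr_gt0 ?pi_gt0.
rewrite /normal_loglik /gauss_nll.
under eq_bigr => i _.
  rewrite /mvnormal_pdf lnM ?posrE ?mulr_gt0 ?powR_gt0 ?expR_gt0 //.
  rewrite lnM ?posrE ?powR_gt0 // !ln_powR expRK mulrDr.
  over.
rewrite big_split /= -mulr_suml w_sum1 mul1r.
have -> : \sum_i w i * - (delta S i / 2) = - (\sum_i w i * delta S i) / 2.
  by rewrite mulNr mulr_suml -sumrN; apply: eq_bigr => i _; rewrite mulrN mulrA.
move: (\sum_i _) => s; lra.
Qed.

End LikelihoodLimits.

(** * Critical points *)

Section OpenSPD.
Context {R : realType} {d : nat}.
Implicit Types (S H : 'M[R]_d).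

Lemma quad_form_le H (u : 'cV[R]_d) :
  `|(u^T *m H *m u) ord0 ord0| <= (\sum_i \sum_j `|H i j|) * (u^T *m u) ord0 ord0.
Proof.
rewrite trmx_mul_col; set q := \sum_i u i ord0 ^+ 2.
have qu i : u i ord0 ^+ 2 <= q.
  by rewrite /q (bigD1 i) //= lerDl sumr_ge0 // => j _; exact: sqr_ge0.
have -> : (u^T *m H *m u) ord0 ord0 = \sum_i \sum_j (u i ord0 * H i j) * u j ord0.
  rewrite mxE exchange_big /=; apply: eq_bigr => j _.
  rewrite mxE mulr_suml; apply: eq_bigr => i _.
  by rewrite mxE.
rewrite mulr_suml; apply: le_trans (ler_norm_sum _ _ _) _; apply: ler_sum => i _.
rewrite mulr_suml; apply: le_trans (ler_norm_sum _ _ _) _; apply: ler_sum => j _.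
rewrite mulrAC normrM [leRHS]mulrC ler_wpM2r // normrM.
have := qu i; have := qu j.
rewrite -(@real_normK _ (u i ord0)) ?num_real // -(@real_normK _ (u j ord0)) ?num_real //.
have := normr_ge0 (u i ord0); have := normr_ge0 (u j ord0).
move: `|u i ord0| `|u j ord0| => p r; nra.
Qed.

(** Conjugation by a factor [C] of [S] turns [S] into the identity and [H] into [H'], whose
    quadratic form is at most [eta] times the squared norm; [eta + 1] also covers [eta = 0]. *)
Lemma SPD_open_sym S H : SPD S -> H^T = H ->
  exists2 e : R, 0 < e & forall t, `|t| < e -> SPD (t *: H + S).
Proof.
move=> SS Hs; have [C Cu SC] := SPD_factor SS.
pose H' := invmx C *m H *m (invmx C)^T.
pose eta := \sum_i \sum_j `|H' i j|.
have eta0 : 0 <= eta by apply: sumr_ge0 => i _; apply: sumr_ge0.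
have e0 : 0 < (eta + 1)^-1 by rewrite invr_gt0 ltr_wpDl.
exists (eta + 1)^-1 => // t te; split.
  by rewrite linearD /= linearZ /= Hs; case: SS => ->.
move=> v v0; pose u := C^T *m v.
have u0 : u != 0.
  apply: contra v0 => /eqP h.
  by rewrite -[v]mul1mx -(mulVmx (_ : C^T \in unitmx)) ?unitmx_tr // -mulmxA -/u h mulmx0.
have q0 := trmx_mul_col_gt0 u0.
have E : v^T *m (t *: H + S) *m v = t *: (u^T *m H' *m u) + u^T *m u.
  rewrite mulmxDr mulmxDl -scalemxAr -scalemxAl /u trmx_mul trmxK SC !mulmxA.
  congr (_ *: _ + _); rewrite -[v^T *m C *m invmx C]mulmxA mulmxV // mulmx1.
  by rewrite trmx_inv -[_ *m invmx C^T *m C^T]mulmxA mulVmx ?unitmx_tr // mulmx1.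
rewrite E mxE [X in X + _]mxE.
have := quad_form_le H' u; rewrite -/eta.
set a := (u^T *m H' *m u) ord0 ord0; set q := (u^T *m u) ord0 ord0 => aq.
have : `|t * a| < q.
  rewrite normrM; apply: (@le_lt_trans _ _ (`|t| * (eta * q))).
    by rewrite ler_wpM2l.
  rewrite mulrA gtr_pMl //; move: te.
  rewrite -[(eta + 1)^-1]mul1r ltr_pdivlMr ?ltr_wpDl //.
  have := normr_ge0 t; nra.
by rewrite ltr_norml => /andP[h _]; lra.
Qed.

End OpenSPD.

Section CriticalPoints.
Context {R : realType} {d n : nat} (x : 'I_n -> 'cV[R]_d) (w : 'I_n -> R).
Hypotheses (hd : (0 < d)%N) (w_gt0 : forall i, 0 < w i)
  (w_sum1 : \sum_(i < n) w i = 1)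
  (x_free : forall I : {set 'I_n}, (#|I| <= d)%N -> free [seq x i | i in I])
  (w_max : forall i, d%:R * w i <= 1).
Local Notation delta S i := (mahalanobis S (x i)).
Local Notation L := (tL x w).
Implicit Types (S : 'M[R]_d) (nu : R).

Lemma derivable_tL_dof S nu : SPD S -> 0 < nu -> derivable (fun u => L u S) nu 1.
Proof.
move=> SS nu0; apply/derivable1_diffP.
have d0 : 0 <= d%:R :> R by [].
have lnG (a : R) : 0 < a + nu ->
    differentiable (fun u : R => ln (Gamma ((a + u) / 2))) nu.
  move=> an0; apply: (@differentiable_comp _ _ _ _ (fun u : R => (a + u) / 2)
    (fun v : R => ln (Gamma v))).
    by apply: differentiableM => //; apply: differentiableD.
  by apply/derivable1_diffP; apply: derivable_lnGamma; lra.
(* Writing [0 + u] lets [lnG] handle both Gamma terms, with [a = d] and [a = 0]. *)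
have -> : (fun u => L u S) = (fun u => - 2 * ln (Gamma ((d%:R + u) / 2))
    + 2 * ln (Gamma ((0 + u) / 2)) - u * ln u
    + (d%:R + u) * \sum_(i < n) w i * ln (u + delta S i) + ln (\det S)).
  by apply/funext => u; rewrite add0r.
apply: differentiableD; last exact: differentiable_cst.
apply: differentiableD.
  apply: differentiableB.
    apply: differentiableD.
      by apply: differentiableM; [exact: differentiable_cst | apply: lnG; lra].
    by apply: differentiableM; [exact: differentiable_cst | apply: lnG; lra].
  by apply: differentiableM => //; exact: differentiable_ln.
apply: differentiableM; first by apply: differentiableD.
apply: differentiable_sum_seq => i.
apply: differentiableM; first exact: differentiable_cst.
apply: differentiable_ln; first by apply: differentiableD.
by rewrite addr_gt0 // (delta_gt0 hd x_free).
Qed.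

(* Differentiability of [tL] is read off this rational form; [invmx] itself is
   defined by cases. *)
Definition tL_adj nu S : R :=
  - 2 * ln (Gamma ((d%:R + nu) / 2)) + 2 * ln (Gamma (nu / 2)) - nu * ln nu
  + (d%:R + nu) * (\sum_(i < n) w i *
      ln (nu + (\det S)^-1 * ((x i)^T *m \adj S *m x i) ord0 ord0))
  + ln (\det S).

Lemma mahalanobis_adj S i : S \in unitmx ->
  (\det S)^-1 * ((x i)^T *m \adj S *m x i) ord0 ord0 = delta S i.
Proof.
by move=> Su; rewrite /mahalanobis /invmx Su -scalemxAr -scalemxAl [RHS]mxE.
Qed.

Lemma tL_adjE nu S : S \in unitmx -> tL_adj nu S = L nu S.
Proof.
move=> Su; rewrite /tL_adj /tL.
by under eq_bigr do rewrite mahalanobis_adj //.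
Qed.

Lemma differentiable_tL_adj nu S : SPD S -> 0 < nu ->
  differentiable (tL_adj nu) S.
Proof.
move=> SS nu0; have D0 := SPD_det_gt0 SS.
have co i j : differentiable (fun A : 'M[R]_d => A i j) S.
  exact: differentiable_coord.
have ddet : differentiable (fun A : 'M[R]_d => \det A) S.
  exact: differentiable_det.
apply: differentiableD; last exact: differentiable_ln.
apply: differentiableD; first exact: differentiable_cst.
apply: differentiableM; first exact: differentiable_cst.
apply: differentiable_sum_seq => i.
apply: differentiableM; first exact: differentiable_cst.
apply: differentiable_ln; last first.
  by rewrite mahalanobis_adj ?SPD_unitmx // addr_gt0 // (delta_gt0 hd x_free).
apply: differentiableD; first exact: differentiable_cst.
apply: differentiableM.
  by apply: differentiableV => //; rewrite gt_eqF.
under eq_fun do rewrite mxE.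
apply: differentiable_sum_seq => j; apply: differentiableM; last exact: differentiable_cst.
under eq_fun do rewrite mxE.
apply: differentiable_sum_seq => k; apply: differentiableM; first exact: differentiable_cst.
exact: differentiable_adj.
Qed.

Lemma argmin_critical p : argminL L p -> critical_point L p.
Proof.
case: p => nu S [[/= nu0 SS] hmin]; split => /=.
  apply: (@derive1_at_min R _ 0 (nu + 1)); first lra.
  - by move=> t; rewrite in_itv /= => /andP[t0 _]; exact: derivable_tL_dof.
  - by rewrite in_itv /= nu0 ltrDl ltr01.
  - by move=> t; rewrite in_itv /= => /andP[t0 _]; exact: (hmin (t, S)).
have df := differentiable_tL_adj SS nu0.
(* Along a symmetric direction the line [t H + S] stays in SPD for small [t], where [tL_adj] equals
   [L] and has its minimum at [t = 0]; a one-variable argument then kills the directional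
   derivative. The full expansion of [tL_adj] at [S] thus loses its linear term on symmetric
   increments. *)
have d0 H : H^T = H -> 'd (tL_adj nu) S H = 0.
  move=> Hs; have [e e0 he] := SPD_open_sym SS Hs.
  have itv t : t \in `](- e), e[ -> SPD (t *: H + S).
    by rewrite in_itv /= => ?; apply: he; rewrite ltr_norml.
  have h : is_derive (0 : R) 1 (fun t : R => tL_adj nu (t *: H + S)) 0.
    apply: (@derive1_at_min R _ (- e) e); first lra.
    - move=> t te; apply/derivable1_diffP.
      apply: (@differentiable_comp _ _ _ _ (fun t : R => t *: H + S) (tL_adj nu)).
        by [].
      by apply: differentiable_tL_adj => //; exact: itv.
    - by rewrite in_itv /= e0 oppr_lt0 e0.
    - move=> t te; rewrite scale0r add0r !tL_adjE ?SPD_unitmx //; last exact: itv.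
      by apply: (hmin (nu, t *: H + S)); split => //=; exact: itv.
  rewrite -deriveE //; have [_ <-] := h; rewrite /derive.
  set f1 := (X in lim (X @ _) = _); set f2 := (X in _ = lim (X @ _)).
  suff -> : f1 = f2 by [].
  apply/funext => t; rewrite /f1 /f2 /=.
  by rewrite addr0 scale0r add0r [_%:A]mulr1.
apply/eqoP => e e0.
have /eqaddoP/(_ e e0) := diff_locally df => h1.
have h2 : \forall H \near (0 : 'M[R]_d), 0 < \det (H + S).
  have c : (fun H => H + S) @ (0 : 'M[R]_d) --> S.
    rewrite -[X in _ --> X]add0r.
    by apply: (@cvgD _ _ _ (nbhs (0 : 'M[R]_d)) _ id (fun=> S)); [exact: cvg_id | exact: cvg_cst].
  have cd := @cvg_det R _ (nbhs (0 : 'M[R]_d)) _ (fun H => H + S) S (nbhs_filter _) c.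
  exact: (@cvgr_gt _ _ (nbhs (0 : 'M[R]_d)) _ _ _ cd _ (SPD_det_gt0 SS)).
apply: filterS2 h1 h2 => H h1 h2 Hs.
have Hu : S + H \in unitmx by rewrite addrC unitmxE unitfE gt_eqF.
move: h1; rewrite -(tL_adjE _ Hu) -(tL_adjE _ (SPD_unitmx SS)) [S + H]addrC.
by rewrite /= !fctE /= d0 // addr0.
Qed.

End CriticalPoints.

(** * Minimizing sequences *)

Section MinimizingSequences.
Context {R : realType} {d n : nat} (x : 'I_n -> 'cV[R]_d) (w : 'I_n -> R).
Hypotheses (hd : (0 < d)%N) (w_gt0 : forall i, 0 < w i)
  (w_sum1 : \sum_(i < n) w i = 1)
  (x_free : forall I : {set 'I_n}, (#|I| <= d)%N -> free [seq x i | i in I])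
  (w_max : forall i, d%:R * w i <= 1).
Local Notation delta S i := (mahalanobis S (x i)).
Local Notation L := (tL x w).
Local Notation Sigma_hat := (\sum_(i < n) w i *: (x i *m (x i)^T)).
Implicit Types (S : 'M[R]_d).

Lemma infL_le p : dom p -> (infL L <= (L p.1 p.2)%:E)%E.
Proof. by move=> dp; apply: ereal_inf_lbound; exists p. Qed.

(** Finiteness of the infimum comes from here: a real limit of the values excludes [-oo] by
    uniqueness of limits in the extended reals. *)
Lemma infL_eq (T : Type) (F : set_system T) (nu : T -> R) (S : T -> 'M[R]_d) (l : R) :
  ProperFilter F -> (L (nu t) (S t))%:E @[t --> F] --> infL L ->
  L (nu t) (S t) @[t --> F] --> l -> infL L = l%:E.
Proof.
move=> FF c1 c2; apply: (cvg_unique (@ereal_hausdorff R) c1).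
by apply: cvg_EFin => //; exact: nearW.
Qed.

Lemma near_tL_le (T : Type) (F : set_system T) (nu : T -> R) (S : T -> 'M[R]_d) p :
  ProperFilter F -> (L (nu t) (S t))%:E @[t --> F] --> infL L -> dom p ->
  \forall t \near F, L (nu t) (S t) <= L p.1 p.2 + 1.
Proof.
move=> FF c1 dp.
(* The margin 1 makes the inequality strict even if [p] is a minimizer, so the values below it form
   a neighbourhood of [infL L], finite or not. *)
have lt : (infL L < (L p.1 p.2 + 1)%:E)%E.
  by apply: le_lt_trans (infL_le dp) _; rewrite lte_fin ltrDl.
have : \forall t \near F, ((L (nu t) (S t))%:E < (L p.1 p.2 + 1)%:E)%E.
  exact: c1 (open_ereal_lt' lt).
by apply: filterS => t; rewrite lte_fin => /ltW.
Qed.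

Lemma SPD1 : SPD (1%:M : 'M[R]_d).
Proof. by rewrite -[1%:M]mulmx1 -{2}trmx1; apply: SPD_mulmx_tr; exact: unitmx1. Qed.

(** [tyler_bound] with [c = nu], after dropping the nonnegative share of [nu], leaves an upper bound
    on [dof_term - d ln nu], the quantity that blows up at 0. *)
Lemma dof_limit_gt0 (T : Type) (F : set_system T) (nu : T -> R) (S : T -> 'M[R]_d) (a : R) :
  ProperFilter F -> (forall t, dom (nu t, S t)) ->
  (L (nu t) (S t))%:E @[t --> F] --> infL L -> nu t @[t --> F] --> a -> 0 < a.
Proof.
move=> FF dS c1 ca.
have p1 : dom (1 : R, 1%:M : 'M[R]_d) by split; [exact: ltr01 | exact: SPD1].
have [C hC] := tyler_bound hd w_gt0 w_sum1 x_free w_max.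
apply: (@dof_term_bounded_gt0 _ _ F nu d a (L 1 1%:M + 1 + C)) => //.
  by move=> t; have [] := dS t.
apply: filterS (near_tL_le FF c1 p1) => t /= ht; have [/= nu0 SS] := dS t.
have h1 := hC (S t) (nu t) SS nu0.
have h2 := sum_ln_delta_ge0 hd w_gt0 x_free nu0 SS.
have h3 := mulr_ge0 (ltW nu0) h2.
move: ht h1 h3; rewrite (tLE hd w_sum1 x_free nu0 SS) mulrDl.
move: (dof_term d (nu t)) (\sum_i _) (L 1 1%:M) => u s l.
lra.
Qed.

Lemma finite_dof_minimizer (U : set_system nat) (nu : nat -> R) (S : nat -> 'M[R]_d) (a : R) :
  UltraFilter U -> (forall t, dom (nu t, S t)) ->
  (L (nu t) (S t))%:E @[t --> U] --> infL L -> nu t @[t --> U] --> a ->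
  exists p, argminL L p.
Proof.
move=> UU dS c1 ca; have a0 : 0 < a by exact: dof_limit_gt0 dS c1 ca.
have p1 : dom (1 : R, 1%:M : 'M[R]_d) by split; [exact: ltr01 | exact: SPD1].
have SS t : SPD (S t) by have [] := dS t.
have nu0 t : 0 < nu t by have [] := dS t.
have a2 : 0 < a / 2 by lra.
have [S0 SS0 cS] : exists2 S0 : 'M[R]_d, SPD S0 & S t @[t --> U] --> S0.
  (* Eventually [a / 2 < nu < 2 a]: the lower bound serves the coefficient [d + nu], the upper one
     the denominators. The 2 collects one unit from [n1] and one from [n4]. *)
  apply: (@SPD_ultra_cvg _ _ _ x w hd w_gt0 w_sum1 x_free w_max _ U S (a / 2) (2 * a)
    (L 1 1%:M + 2 - dof_term d a)) => //; first lra.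
  have n1 : \forall t \near U, L (nu t) (S t) <= L 1 1%:M + 1.
    exact: near_tL_le c1 p1.
  have n2 : \forall t \near U, nu t < 2 * a by apply: cvgr_lt ca _ _; lra.
  have n3 : \forall t \near U, a / 2 < nu t by apply: cvgr_gt ca _ _; lra.
  have n4 : \forall t \near U, dof_term d a - 1 < dof_term d (nu t).
    have cd : dof_term d (nu t) @[t --> U] --> dof_term d a by exact: dof_term_cvg.
    by apply: cvgr_gt cd _ _; rewrite ltrBlDr ltrDl.
  apply: filterS (filterI (filterI n1 n2) (filterI n3 n4)) => t [[h1 h2] [h3 h4]].
  have h5 : \sum_i w i * ln (1 + delta (S t) i / (2 * a)) <=
            \sum_i w i * ln (1 + delta (S t) i / nu t).
    apply: ler_sum => i _; rewrite ler_pM2l //.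
    have d0 := delta_gt0 hd x_free i (SS t).
    rewrite ler_ln ?posrE ?addr_gt0 ?divr_gt0 ?mulr_gt0 // lerD2l ler_pM2l //.
    by rewrite lef_pV2 ?posrE ?mulr_gt0 // ltW.
  have h6 := sum_ln_delta_ge0 hd w_gt0 x_free (nu0 t) (SS t).
  have h7 := sum_ln_delta_ge0 hd w_gt0 x_free (_ : 0 < 2 * a) (SS t).
  have d0 : 0 <= d%:R :> R by [].
  have h8 : (d%:R + a / 2) * (\sum_i w i * ln (1 + delta (S t) i / (2 * a))) <=
            (d%:R + nu t) * (\sum_i w i * ln (1 + delta (S t) i / nu t)).
    by apply: ler_pM => //; [lra | apply: h7; lra | lra].
  move: h1 h4 h8; rewrite (tLE hd w_sum1 x_free (nu0 t) (SS t)) /=.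
  move: (dof_term d a) (dof_term d (nu t)) (L 1 1%:M) (_ * \sum_i _) (_ * \sum_i _).
  by move=> u1 u2 u3 u4 u5; lra.
exists (a, S0); split; first by split.
have E : infL L = (L a S0)%:E by apply: infL_eq c1 _; exact: tL_cvg.
by move=> q dq; have := infL_le dq; rewrite E lee_fin.
Qed.

Lemma infinite_dof_cvg (U : set_system nat) (nu : nat -> R) (S : nat -> 'M[R]_d) :
  UltraFilter U -> (forall t, dom (nu t, S t)) ->
  (L (nu t) (S t))%:E @[t --> U] --> infL L -> nu t @[t --> U] --> +oo ->
  S t @[t --> U] --> Sigma_hat.
Proof.
move=> UU dS c1 cnu.
have p1 : dom (1 : R, 1%:M : 'M[R]_d) by split; [exact: ltr01 | exact: SPD1].
have SS t : SPD (S t) by have [] := dS t.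
have nu0 t : 0 < nu t by have [] := dS t.
have d0 : 0 <= d%:R :> R by [].
have [S0 SS0 cS] : exists2 S0 : 'M[R]_d, SPD S0 & S t @[t --> U] --> S0.
  (* With [b = d + 1], monotonicity of [nu ln (1 + delta / nu)] gives the coefficient [d + 1], which
     leaves a surplus [a = 1] over [d]. *)
  apply: (@SPD_ultra_cvg _ _ _ x w hd w_gt0 w_sum1 x_free w_max _ U S 1 (d%:R + 1)
    (L 1 1%:M + 2 - d%:R * ln 2)) => //.
  have n1 : \forall t \near U, L (nu t) (S t) <= L 1 1%:M + 1.
    exact: near_tL_le c1 p1.
  have n2 : \forall t \near U, d%:R + 1 < nu t by exact: cvgry_gt.
  have n3 : \forall t \near U, d%:R * ln 2 - 1 < dof_term d (nu t).
    have cd : dof_term d (nu t) @[t --> U] --> d%:R * ln 2 by exact: dof_term_cvgy.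
    by apply: cvgr_gt cd _ _; rewrite ltrBlDr ltrDl.
  apply: filterS (filterI n1 (filterI n2 n3)) => t [h1 [h2 h3]].
  have h4 : (d%:R + 1) * (\sum_i w i * ln (1 + delta (S t) i / (d%:R + 1))) <=
            (d%:R + nu t) * (\sum_i w i * ln (1 + delta (S t) i / nu t)).
    apply: (@le_trans _ _ (nu t * (\sum_i w i * ln (1 + delta (S t) i / nu t)))).
      rewrite !mulr_sumr; apply: ler_sum => i _; rewrite !(mulrCA _ (w i)).
      rewrite ler_pM2l //; apply: mul_ln_1D_div_nondecreasing; rewrite ?ltr_wpDl //.
        exact: ltW.
      exact: (ltW (delta_gt0 hd x_free i (SS t))).
    rewrite ler_wpM2r ?lerDr //.
    exact: (sum_ln_delta_ge0 hd w_gt0 x_free (nu0 t) (SS t)).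
  move: h1 h3 h4; rewrite (tLE hd w_sum1 x_free (nu0 t) (SS t)) /=.
  move: (dof_term d (nu t)) (L 1 1%:M) (_ * \sum_i _) (_ * \sum_i _).
  by move=> u2 u3 u4 u5; lra.
have E : infL L = (d%:R * ln 2 + gauss_nll x w S0)%:E.
  by apply: infL_eq c1 _; exact: tL_cvgy.
have SH := sigma_hat_SPD hd w_gt0 w_sum1 x_free w_max.
have [_ h2] := gauss_nll_min hd w_gt0 w_sum1 x_free w_max SS0.
rewrite -h2 //.
(* Test points with scatter [Sigma_hat] and growing [nu]: in the limit [S0] does at least as well as
   [Sigma_hat] for the Gaussian likelihood, and uniqueness of its minimizer identifies them. *)
have le : \forall k \near \oo, d%:R * ln 2 + gauss_nll x w S0 <= L k.+1%:R Sigma_hat.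
  apply: nearW => k; rewrite -lee_fin -E.
  by apply: (@infL_le (k.+1%:R, Sigma_hat)); split => //=; rewrite ltr0n.
have c2 : L k.+1%:R Sigma_hat @[k --> \oo] --> d%:R * ln 2 + gauss_nll x w Sigma_hat.
  apply: (@tL_cvgy _ _ _ x w hd w_sum1 x_free _ \oo (fun k => k.+1%:R) (fun=> Sigma_hat)) => //.
    apply/cvgryPge => A; exists (Num.truncn A).+1 => //= k Ak.
    apply: le_trans (ltW (truncnS_gt A)) _; rewrite ler_nat.
    exact: leq_trans Ak _.
  exact: cvg_cst.
rewrite -(lerD2l (d%:R * ln 2)) -(cvg_lim _ c2) //.
by apply: limr_ge => //; apply/cvg_ex; eexists; exact: c2.
Qed.

End MinimizingSequences.

Lemma increasing_seq_cvgy (f : nat -> nat) : increasing_seq f -> f k @[k --> \oo] --> \oo.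
Proof.
move=> /increasing_seqP fS A [N _ NA]; exists N => // k /= Nk; apply: NA => /=.
apply: leq_trans Nk _; elim: k => // k; move=> h.
by apply: leq_ltn_trans h _; exact: fS.
Qed.

Theorem theorem3p2 (R : realType) (d n : nat) (hd : (0 < d)%N)
    (x : 'I_n -> 'cV[R]_d) (w : 'I_n -> R)
    (w_gt0 : forall i, 0 < w i) (w_sum1 : \sum_(i < n) w i = 1)
    (x_free : forall I : {set 'I_n}, (#|I| <= d)%N -> free [seq x i | i in I])
    (w_max : \big[Num.max/0]_(i < n) w i < 1 / d%:R) :
  let L := tL x w in
  let Sigma_hat := \sum_(i < n) w i *: (x i *m (x i)^T) in
  let case_i := exists nu Sigma, minimizing_seq L nu Sigma /\
                  exists a : R, finite_cluster_point nu a in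
  let case_ii := forall nu Sigma, minimizing_seq L nu Sigma ->
                   nu r @[r --> \oo] --> +oo in
  [/\ (case_i \/ case_ii) /\ ~ (case_i /\ case_ii),
      case_i -> argminL L !=set0 /\
                (forall p, argminL L p -> critical_point L p) &
      case_ii -> (forall nu Sigma, minimizing_seq L nu Sigma ->
                    Sigma r @[r --> \oo] --> Sigma_hat) /\
                 normal_MLE x w = [set Sigma_hat]].
Proof.
have {}w_max i : d%:R * w i <= 1.
  rewrite mulrC -ler_pdivlMr ?ltr0n //; apply: le_trans (ltW w_max).
  exact: le_bigmax.
move=> L Sigma_hat case_i case_ii; split.
- split; last first.
    move=> [[nu [S [mS [a [f fincr fa]]]]] /(_ nu S mS) nuy].
    have fy : nu (f k) @[k --> \oo] --> +oo.
      exact: (cvg_comp f nu (increasing_seq_cvgy fincr) nuy).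
    have n1 : \forall k \near \oo, nu (f k) < a + 1 by apply: cvgr_lt fa _ _; lra.
    have n2 : \forall k \near \oo, a + 1 < nu (f k) by exact: cvgry_gt.
    by have [k [h1 h2]] := filter_ex (filterI n1 n2); have := lt_trans h1 h2; rewrite ltxx.
  have [|ni] := pselect case_i; first by left.
  right => nu S mS; apply/cvgryPge => A; apply: contrapT => nA; apply: ni.
  exists nu, S; split => //.
  (* If [nu] does not tend to infinity, some ultrafilter finer than [\oo] keeps it between 0 and a
     fixed [A]; its limit there is a cluster value, hence the limit of a subsequence. *)
  have [U [UU FU UnA]] := not_filter_ultra _ nA.
  have [a ca] : exists a : R, nu t @[t --> U] --> a.
    apply: (ultra_bounded_cvg UU (B := `|A|)); apply: filterS UnA => t /= /negP.
    rewrite -ltNge => tA; have [/= t0 _] := mS.1 t.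
    by rewrite gtr0_norm // ltW // (lt_le_trans tA) // ler_norm.
  exists a; apply/cluster_eventually_cvg => B C FB aC.
  have UB : U (nu @^-1` B) by exact: FU.
  have UC : U (nu @^-1` C) by exact: ca.
  by have [t [Bt Ct]] := filter_ex (filterI UB UC); exists (nu t).
- move=> [nu [S [[dS cS] [a [f fincr fa]]]]]; split; last first.
    by move=> p; exact: argmin_critical.
  have [U [UU FU]] := ultraFilterLemma (F := \oo) _.
  have cf : (L (nu (f k)) (S (f k)))%:E @[k --> \oo] --> infL L.
    exact: (cvg_comp f (fun r => (L (nu r) (S r))%:E) (increasing_seq_cvgy fincr) cS).
  apply: (finite_dof_minimizer hd w_gt0 w_sum1 x_free w_max UU
    (nu := nu \o f) (S := S \o f) (a := a)).
  + by move=> k; exact: dS.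
  + by move=> A lA; exact: (FU _ (cf A lA)).
  + by move=> A lA; exact: (FU _ (fa A lA)).
- move=> cii; have SH := sigma_hat_SPD hd w_gt0 w_sum1 x_free w_max.
  split.
    move=> nu S mS; apply: cvg_ultra_sub => U UU FU.
    apply: (infinite_dof_cvg hd w_gt0 w_sum1 x_free w_max (nu := nu)) => //.
    + exact: mS.1.
    + by move=> A lA; exact: (FU _ (mS.2 A lA)).
    + by move=> A lA; exact: (FU _ (cii _ _ mS A lA)).
  have le S : SPD S -> normal_loglik x w S <= normal_loglik x w Sigma_hat.
    move=> SS; rewrite (normal_loglikE x w_sum1 SS) (normal_loglikE x w_sum1 SH).
    rewrite lerD2l lerN2 ler_pM2r ?invr_gt0 //.
    by have [] := gauss_nll_min hd w_gt0 w_sum1 x_free w_max SS.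
  apply/seteqP; split => S /=; last by move=> ->; split.
  move=> [SS] /(_ _ SH); rewrite (normal_loglikE x w_sum1 SS) (normal_loglikE x w_sum1 SH).
  rewrite lerD2l lerN2 ler_pM2r ?invr_gt0 // => h.
  by have [_] := gauss_nll_min hd w_gt0 w_sum1 x_free w_max SS; exact.
Qed.
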